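(* Let $n\ge 2$ and $m\ge k\ge 1$ be integers and let $\alpha=\dim P_{n,2k}-1$. Then \[ \left(\frac{\operatorname{vol}\,\overline{K}(2m)}{\operatorname{vol}\,\overline{C}}\right)^{1/\alpha}\ \ge\ \frac{m!\,\Gamma\!\left(\frac{2m+n}{2}\right)}{(m-k)!\,\Gamma\!\left(\frac{2m+2k+n}{2}\right)}, \] where volumes are $\alpha$-dimensional volumes in the affine hyperplane $M$.
   Context: $P_{n,d}$ is the real vector space of homogeneous polynomials (forms) of degree $d$ in $n$ real variables, and $r^2=x_1^2+\dots+x_n^2$. $\sigma$ is the rotation-invariant probability measure on the unit sphere $S^{n-1}$. $M=\{f\in P_{n,2k}:\int_{S^{n-1}} f\,d\sigma=1\}$, an affine hyperplane of dimension $\alpha=\dim P_{n,2k}-1$. $C=\{f\in P_{n,2k}: f(x)\ge 0\ \forall x\in\mathbb R^n\}$ and $\overline C=C\cap M$. $L\!f_{n,2m}=\{\sum_i l_i^{2m}: l_i \text{ linear forms}\}\subseteq P_{n,2m}$ (finite sums). For $m\ge k$, $K(2m)=\{f\in P_{n,2k}: r^{2(m-k)}f\in L\!f_{n,2m}\}$ and $\overline K(2m)=K(2m)\cap M$. *)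

(* Defs.v *)
From HB Require Import structures.
From mathcomp Require Import all_boot all_order all_algebra.
From mathcomp Require Import all_classical all_reals all_analysis.
Set Implicit Arguments. Unset Strict Implicit. Unset Printing Implicit Defensive.
Import Order.TTheory GRing.Theory Num.Theory.
Local Open Scope classical_set_scope.
Local Open Scope ring_scope.

Section Defs.
Variable R : realType.

(* ---------- Lebesgue measure on R^I (I a finite type), as an iterated
   integral of the indicator over the coordinates (Tonelli) ---------- *)
Definition upd (I : finType) (x : I -> R) (i : I) (t : R) : I -> R :=
  fun j => if j == i then t else x j.

Fixpoint iter_int (I : finType) (s : seq I) (F : (I -> R) -> \bar R)
    (x : I -> R) : \bar R :=
  match s with
  | [::] => F x
  | i :: s' => (\int[@lebesgue_measure R]_t iter_int s' F (upd x i t))%E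
  end.

Definition leb_int (I : finType) (F : (I -> R) -> \bar R) : \bar R :=
  iter_int (enum I) F (fun _ => 0).

Definition leb_vol (I : finType) (A : set (I -> R)) : \bar R :=
  leb_int (fun x => (\1_A x)%:E).

Definition r2 (n : nat) (x : 'I_n -> R) : R := \sum_(i < n) x i ^+ 2.
Definition enorm (n : nat) (x : 'I_n -> R) : R := Num.sqrt (r2 x).
Definition unit_ball (n : nat) : set ('I_n -> R) := [set x | enorm x <= 1].

(* sigma = rotation invariant probability measure on S^{n-1}, realized as the
   normalized cone measure: sigma(A) = vol{x in ball | x/|x| in A} / vol(ball).
   sphere_int n g = \int_{S^{n-1}} g dsigma *)
Definition sphere_int (n : nat) (g : ('I_n -> R) -> R) : \bar R :=
  (leb_int (fun x => (\1_(@unit_ball n) x * g (fun i => x i / enorm x))%:E)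
   * (fine (leb_vol (@unit_ball n)))^-1%:E)%E.

Definition Mon (n d : nat) :=
  {e : n.-tuple 'I_d.+1 | \sum_(i < n) (tnth e i : nat) == d}.

Definition ev (n d : nat) (c : Mon n d -> R) (x : 'I_n -> R) : R :=
  \sum_(e : Mon n d) c e * \prod_(i < n) x i ^+ (tnth (val e) i).

Definition alpha (n d : nat) : nat := (#|{: Mon n d}| - 1)%N.

Definition Cpsd (n k : nat) : set (Mon n k.*2 -> R) :=
  [set c | forall x, 0 <= ev c x].

(* K(2m) = { f in P_{n,2k} : r^{2(m-k)} f is a finite sum of 2m-th powers of
   linear forms } ; the product r^{2(m-k)} f and the sum of powers are forms of
   degree 2m, compared as polynomial functions *)
Definition Kcone (n k m : nat) : set (Mon n k.*2 -> R) :=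
  [set c | exists ls : seq ('I_n -> R), forall x : 'I_n -> R,
      r2 x ^+ (m - k) * ev c x
      = \sum_(a <- ls) (\sum_(i < n) a i * x i) ^+ (m.*2)].

Definition Mhyp (n d : nat) : set (Mon n d -> R) :=
  [set c | sphere_int (ev c) = 1%E].

(* the monomial x_1^d (the only exponent vector with d at index 0) *)
Definition is_first_pure (n d : nat) (e : Mon n d) : bool :=
  [exists i : 'I_n, (val i == 0%N) && ((tnth (val e) i : nat) == d)].

(* affine coordinates on M: all coefficients except that of x_1^d *)
Definition MonRest (n d : nat) := {e : Mon n d | ~~ is_first_pure e}.

Definition proj_rest (n d : nat) (c : Mon n d -> R) : MonRest n d -> R :=
  fun e => c (val e).

(* alpha-dimensional volume of a subset S of M, in the affine coordinates of M
   given by proj_rest (injective on M); any other choice of Euclidean/affine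
   coordinates on M only multiplies all volumes by the same constant *)
Definition volM (n d : nat) (S : set (Mon n d -> R)) : \bar R :=
  leb_vol (@proj_rest n d @` (S `&` @Mhyp n d)).

Definition Gamma (s : R) : R :=
  fine (\int[@lebesgue_measure R]_(t in `]0%R, +oo[) (powR t (s - 1) * expR (- t))%:E)%E.

End Defs.

(* Main.v *)
Require Import Defs.
From HB Require Import structures.
From mathcomp Require Import all_boot all_order all_algebra all_fingroup.
From mathcomp Require Import zify ring lra boolp.
From mathcomp Require complex.
From mathcomp.multinomials Require mpoly.
Set Implicit Arguments. Unset Strict Implicit. Unset Printing Implicit Defensive.
Import Order.TTheory GRing.Theory Num.Theory.
Local Open Scope ring_scope.

(* For a positive semidefinite form f of degree 2k, the Gaussian average
   T f (x) = E[f(V) <x,V>^(2m)] is a finite sum of 2m-th powers of linear forms: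
   up to the degrees involved, the Gaussian measure can be replaced by a product
   of positive quadrature rules.  Gaussian integration by parts gives
     T f = (2m)! r^(2(m-k)) sum_i a_i r^(2i) Delta^i f,
     a_i = 1 / (2^i i! 2^(m-k+i) (m-k+i)!).
   Moreover r^(2i) Delta^i is a polynomial prod_(l < i) (E - eps_l) in
   E = r^2 Delta, whose eigenvalues eps_0 < ... < eps_k on forms of degree 2k are
   distinct, so E is diagonalizable.  Since the spherical mean of E f is eps_k
   times that of f, the operator L = sum_i a_i r^(2i) Delta^i multiplies the
   spherical mean by the constant c_0 = sum_i a_i prod_(l < i) (eps_k - eps_l),
   and L / c_0 maps the section of the psd cone by M into that of K(2m).  Its
   linear part on the direction of M has all eigenvalues at least a_0 / c_0, so
   it multiplies volumes by at least (a_0 / c_0)^alpha.  Finally, by the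
   Chu-Vandermonde identity, a_0 / c_0 is the stated quotient of Gamma values. *)

(** * Laplacian and Gaussian integration by parts *)

(** Gaussian rather than spherical averages are used because independent coordinates allow a product
    quadrature: [T f] is then literally a finite sum with nonnegative weights, and no closedness of
    the cone of sums of powers enters. The price is the link with the sphere. Spherical mean and
    Gaussian average are both invariant enough to agree, up to one factor, on powers of linear
    forms, and these span because [L] for m = k is invertible. The lower bound for the eigenvalues
    of [L] comes from the order of the eps: at eps_s the product over l < i of (eps_s - eps_l) is
    zero for i > s and nonnegative for i <= s, so only nonnegative terms are added to a_0. On
    harmonic forms (s = 0) the value is exactly a_0. The assumption n >= 2 makes the eps strictly
    increasing. Volumes are real parts of extended integrals, so the psd section must be shown to
    have finite positive volume. Finiteness is drawn from the case m = k: there [L] sends the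
    section into the span of finitely many fixed powers with bounded coefficients, hence into a
    box. *)

Module Forms.
Import mpoly.
Section Laplacian.
Variables (R : realFieldType) (n : nat).
Implicit Types (p q f g : {mpoly R[n]}) (i j : 'I_n) (d : nat).

Definition r2p : {mpoly R[n]} := \sum_i 'X_i ^+ 2.
Definition lap p := \sum_i p^`M(i)^`M(i).
Definition linp (x : 'I_n -> R) : {mpoly R[n]} := \sum_i x i *: 'X_i.

Lemma lap_is_linear : linear lap.
Proof.
move=> a p q; rewrite /lap scaler_sumr -big_split /=.
by apply: eq_bigr => i _; rewrite !linearP.
Qed.
HB.instance Definition _ :=
  GRing.isLinear.Build R {mpoly R[n]} {mpoly R[n]} _ lap lap_is_linear.

Lemma mderivXU i j : ('X_j : {mpoly R[n]})^`M(i) = (i == j)%:R.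
Proof.
rewrite mderivX mnm1E eq_sym; case: eqP => [->|_]; last by rewrite scale0r.
by rewrite scale1r -[X in 'X_[X - _]]add0m addmK mpolyX0.
Qed.

(** Linearity is a hypothesis on bare functions, so that maps written on the spot, such as
    quadrature sums, can be compared monomial by monomial. *)
Lemma homog_eq_linear (V : lmodType R) (F F' : {mpoly R[n]} -> V) d p :
  linear F -> linear F' -> p \is d.-homog ->
  (forall m, mdeg m = d -> F 'X_[m] = F' 'X_[m]) -> F p = F' p.
Proof.
move=> lF lF' hp h.
pose lf := GRing.isLinear.Build R {mpoly R[n]} V _ F lF.
pose lf' := GRing.isLinear.Build R {mpoly R[n]} V _ F' lF'.
pose FF : {linear {mpoly R[n]} -> V} := HB.pack F lf.
pose FF' : {linear {mpoly R[n]} -> V} := HB.pack F' lf'.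
have -> : F p = FF p by [].
have -> : F' p = FF' p by [].
rewrite (mpolyE p) !linear_sum big_seq [RHS]big_seq; apply: eq_bigr => m hm.
by rewrite !linearZ /= h // (dhomog_mf hp).
Qed.

Lemma mderiv_homog i d p : p \is d.-homog -> p^`M(i) \is d.-1.-homog.
Proof.
move=> hp; apply/dhomogP => m; rewrite mcoeff_msupp mcoeff_deriv => hm.
have hm' : (m + U_(i))%MM \in msupp p.
  by rewrite mcoeff_msupp; apply: contra_neq hm => ->; rewrite mul0rn.
by have := dhomog_mf hp hm'; rewrite /= mdegD mdeg1 addn1 => <-.
Qed.

Lemma mderiv_homog0 i p : p \is 0.-homog -> p^`M(i) = 0.
Proof.
move=> hp; apply/mpolyP => m; rewrite mcoeff_deriv mcoeff0.
by rewrite (dhomog_nemf_coeff hp) ?mul0rn //= mdegD mdeg1 addn1.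
Qed.

Lemma lap_homog d p : p \is d.-homog -> lap p \is (d - 2).-homog.
Proof.
move=> hp; rewrite subn2; apply: rpred_sum => i _.
by apply: mderiv_homog; apply: mderiv_homog.
Qed.

Lemma lap_homog_small d p : (d < 2)%N -> p \is d.-homog -> lap p = 0.
Proof.
move=> hd hp; apply: big1 => i _; apply: mderiv_homog0.
by move: (mderiv_homog i hp); case: d hd {hp} => [|[|d]].
Qed.

Lemma iter_lap_homog d (i : nat) p : p \is d.-homog -> iter i lap p \is (d - i.*2).-homog.
Proof.
move=> hp; elim: i => [|i IH]; first by rewrite subn0.
by rewrite iterS doubleS -addn2 subnDA; apply: lap_homog.
Qed.

Lemma iter_lap_big d (i : nat) p : (d < i.*2)%N -> p \is d.-homog -> iter i lap p = 0.
Proof.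
case: i => [|i]; first by rewrite ltn0.
rewrite doubleS ltnS => hd hp; rewrite iterS.
by apply: lap_homog_small (iter_lap_homog i hp); lia.
Qed.

Lemma euler d p : p \is d.-homog -> \sum_i 'X_i * p^`M(i) = d%:R *: p.
Proof.
move=> hp.
apply: (@homog_eq_linear _ (fun p => \sum_i 'X_i * p^`M(i)) (fun p => d%:R *: p) _ _ _ _ hp).
- move=> a f g; rewrite scaler_sumr -big_split /=; apply: eq_bigr => i _.
  by rewrite linearP mulrDr scalerAr.
- by move=> a f g; rewrite scalerDr !scalerA mulrC.
move=> m <-; rewrite mdegE natr_sum scaler_suml; apply: eq_bigr => i _.
rewrite mderivX -scalerAr -mpolyXD.
case: (posnP (m i)) => [->|hi]; first by rewrite !scale0r.
rewrite addmC submK //; apply/mnm_lepP => j; rewrite mnm1E.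
by case: eqP => [<-|].
Qed.

Lemma mderivXXU i j : ('X_j ^+ 2 : {mpoly R[n]})^`M(i) = ((i == j)%:R * 2) *: 'X_j.
Proof.
rewrite expr2 mderivM mderivXU; case: eqP => _; rewrite ?mul0r ?scale0r ?mul0r ?mulr0 ?addr0 //.
by rewrite !mul1r mulr1 scaler_nat mulr2n.
Qed.

Lemma mderiv_r2p i : r2p^`M(i) = 2 *: 'X_i.
Proof.
rewrite /r2p linear_sum (bigD1 i) //= big1 => [|j hj].
  by rewrite mderivXXU eqxx mul1r addr0.
by rewrite mderivXXU eq_sym (negbTE hj) mul0r scale0r.
Qed.

(** The cross terms of the product rule sum to 4 times the Euler operator, which acts on forms of
    degree d as the scalar d. *)
Lemma lap_r2p d p : p \is d.-homog ->
  lap (r2p * p) = r2p * lap p + (4 * d%:R + 2 * n%:R) *: p.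
Proof.
move=> hp; rewrite /lap mulr_sumr.
have E i : (r2p * p)^`M(i)^`M(i) =
    r2p * p^`M(i)^`M(i) + (4 *: ('X_i * p^`M(i)) + 2 *: p).
  rewrite !(mderivM, mderivD, mderiv_r2p, mderivZ, mderivXU) eqxx.
  rewrite -!scalerAl mul1r !scaler_nat; ring.
under eq_bigr => i _ do rewrite /= E.
rewrite big_split big_split /= -scaler_sumr (euler hp) sumr_const card_ord.
by rewrite -scaler_nat !scalerA -scalerDl [n%:R * 2]mulrC.
Qed.

Lemma r2p_homog : r2p \is 2.-homog.
Proof.
apply: rpred_sum => i _; apply: (@dhomogMn _ _ _ 1).
by rewrite dhomogX /= mdeg1.
Qed.

Lemma r2pX_homog (i : nat) : r2p ^+ i \is (i.*2).-homog.
Proof. by rewrite -muln2 mulnC; apply: dhomogMn r2p_homog. Qed.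

Lemma lap_r2pX d (i : nat) p : p \is d.-homog ->
  lap (r2p ^+ i.+1 * p) = r2p ^+ i.+1 * lap p
   + (2 * i.+1%:R * (2 * i%:R + 2 * d%:R + n%:R)) *: (r2p ^+ i * p).
Proof.
elim: i => [|i IH] hp.
  by rewrite !expr1 expr0 mul1r (lap_r2p hp); congr (_ + _ *: _); ring.
have hq : r2p ^+ i.+1 * p \is (i.+1.*2 + d).-homog.
  by apply: dhomogM => //; apply: r2pX_homog.
rewrite exprS -mulrA (lap_r2p hq) IH // mulrDr -scalerAr [r2p * (r2p ^+ i * p)]mulrA -exprS.
rewrite -!addrA -scalerDl mulrA; congr (_ + _ *: _).
by rewrite natrD -muln2 natrM -!natr1; ring.
Qed.

Definition r2lap (i : nat) p := r2p ^+ i * iter i lap p.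

Lemma r2lap_homog k (i : nat) p : (i <= k)%N -> p \is (k.*2).-homog -> r2lap i p \is (k.*2).-homog.
Proof.
move=> hi hp; have -> : (k.*2 = i.*2 + (k.*2 - i.*2))%N by lia.
by apply: dhomogM; [apply: r2pX_homog | apply: iter_lap_homog].
Qed.

(** The eigenvalue of E = r^2 Delta on r^(2i) h with h harmonic of degree 2k - 2i; index k belongs
    to the multiples of r^(2k). *)
Definition epsl k (i : nat) : R := 2 * i%:R * (4 * k%:R - 2 * i%:R + n%:R - 2).

(** This is [lap_r2pX] applied to Delta^i p, of degree 2k - 2i. Iterated, it gives r^(2i) Delta^i =
    prod_(l < i) (E - eps_l). *)
Lemma r2lapS k (i : nat) p : (i <= k)%N -> p \is (k.*2).-homog ->
  r2lap i.+1 p = r2p * lap (r2lap i p) - epsl k i *: r2lap i p.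
Proof.
move=> hi hp; rewrite /r2lap /epsl iterS.
have hq : iter i lap p \is (k.*2 - i.*2).-homog by apply: iter_lap_homog.
case: i hi hq => [|i] hi hq.
  by rewrite !expr0 !mul1r /= mulr0 mul0r scale0r subr0 expr1.
rewrite (lap_r2pX i hq) mulrDr mulrA -exprS -scalerAr [r2p * (r2p ^+ i * _)]mulrA -exprS.
rewrite -addrA -scalerBl natrB; last by lia.
rewrite [X in X *: _](_ : _ = 0) ?scale0r ?addr0 // -!muln2 !natrM -!natr1.
by ring.
Qed.

End Laplacian.

(** * Moments of a functional with Gaussian integration by parts up to degree N *)

Section Stein.
Variables (R : realFieldType) (n N : nat) (G : {mpoly R[n]} -> R).
Hypothesis linG : scalar G.
Hypothesis G1 : G 1 = 1.
Hypothesis stein : forall i d g, g \is d.-homog -> (d < N)%N ->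
  G ('X_i * g) = G (g^`M(i)).
Implicit Types (p q f g : {mpoly R[n]}).

HB.instance Definition _ := GRing.isLinear.Build R {mpoly R[n]} R _ G linG.

Let GZ a f : G (a *: f) = a * G f. Proof. by rewrite linearZ. Qed.
Let GD f g : G (f + g) = G f + G g. Proof. by rewrite linearD. Qed.

(** Integrate by parts in each second derivative, then apply Euler's identity. The degree bound is
    carried along because a finite quadrature rule satisfies Stein's identity only up to a certain
    degree. *)
Lemma G_lap d f : f \is d.-homog -> (d <= N)%N -> G (lap f) = d%:R * G f.
Proof.
case: d => [|d] hf hd.
  by rewrite (lap_homog_small _ hf) // linear0 mul0r.
rewrite -GZ -(euler hf) /lap !linear_sum.
apply: eq_bigr => i _ /=; rewrite (@stein i d) //.
exact: mderiv_homog hf.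
Qed.

Lemma G_r2p d f : f \is d.-homog -> (d + 2 <= N)%N ->
  G (r2p R n * f) = (n%:R + d%:R) * G f.
Proof.
move=> hf hd; rewrite /r2p mulr_suml linear_sum.
have E i : G ('X_i ^+ 2 * f) = G f + G ('X_i * f^`M(i)).
  have hXf : 'X_i * f \is d.+1.-homog.
    by apply: (@dhomogM _ _ _ 1%N) => //; rewrite dhomogX /= mdeg1.
  rewrite expr2 -mulrA (stein _ hXf) ?mderivM; last by lia.
  by rewrite mderivXU eqxx mul1r linearD.
under eq_bigr => i _ do rewrite /= E.
rewrite big_split sumr_const card_ord -linear_sum (euler hf) /= GZ mulrDl.
by rewrite !mulr_natl.
Qed.

(** [G] sees E only through its top eigenvalue, the one of r^(2k): 2k comes from [G_lap] and n + 2k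
    - 2 from [G_r2p]. *)
Lemma G_r2plap k f : f \is (k.*2).-homog -> (k.*2 <= N)%N ->
  G (r2p R n * lap f) = epsl R n k k * G f.
Proof.
move=> hf hN.
have [k0|k0] := posnP k.
  rewrite k0 in hf *.
  by rewrite (lap_homog_small _ hf) // mulr0 linear0 /epsl mulr0 !mul0r.
rewrite (G_r2p (lap_homog hf)) ?(G_lap hf) //; last by lia.
rewrite /epsl mulrA natrB; last by lia.
by rewrite -muln2 natrM; congr (_ * _); ring.
Qed.

Lemma linp_mderiv (x : 'I_n -> R) (i : 'I_n) : (linp x)^`M(i) = (x i)%:MP.
Proof.
rewrite /linp linear_sum (bigD1 i) //= big1 => [|j hj].
  by rewrite mderivZ mderivXU eqxx addr0 -mul_mpolyC mulr1.
by rewrite mderivZ mderivXU eq_sym (negbTE hj) scaler0.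
Qed.

Lemma linp_homog (x : 'I_n -> R) : linp x \is 1.-homog.
Proof. by apply: rpred_sum => i _; apply: dhomogZ; rewrite dhomogX /= mdeg1. Qed.

Lemma mderivX_linp (x : 'I_n -> R) (i : 'I_n) (p : nat) :
  (linp x ^+ p)^`M(i) = (p%:R * x i) *: linp x ^+ p.-1.
Proof.
elim: p => [|p IH]; first by rewrite expr0 mul0r scale0r -mpolyC1 mderivC.
rewrite exprS mderivM linp_mderiv IH mul_mpolyC -scalerAr.
case: p {IH} => [|p]; first by rewrite !mul0r scale0r addr0 mul1r.
by rewrite -exprS -scalerDl -!natr1; congr (_ *: _); ring.
Qed.

Lemma r2pE (x : 'I_n -> R) : (r2p R n).@[x] = \sum_i x i ^+ 2.
Proof.
by rewrite /r2p raddf_sum; apply: eq_bigr => i _ /=; rewrite rmorphXn /= mevalXU.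
Qed.

(** One factor [linp x] is integrated by parts. The last term comes from the p remaining factors;
    for p = 0 its coefficient is zero and the truncated exponent is harmless. *)
Lemma G_linpS (x : 'I_n -> R) (d p : nat) f : f \is d.-homog -> (d + p.+1 <= N)%N ->
  G (f * linp x ^+ p.+1) =
    \sum_i x i * G (f^`M(i) * linp x ^+ p)
    + p%:R * (r2p R n).@[x] * G (f * linp x ^+ p.-1).
Proof.
move=> hf hN.
rewrite exprS {1}/linp mulr_suml mulr_sumr linear_sum.
have E i : G (f * (x i *: 'X_i * linp x ^+ p)) = x i * G (f^`M(i) * linp x ^+ p)
   + p%:R * x i ^+ 2 * G (f * linp x ^+ p.-1).
  rewrite -scalerAl -scalerAr GZ mulrCA.
  have h1 : f * linp x ^+ p \is (d + p).-homog.
    by apply: dhomogM => //; have := dhomogMn p (linp_homog x); rewrite mul1n.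
  rewrite (stein _ h1); last by lia.
  rewrite mderivM GD mderivX_linp -scalerAr GZ mulrDr.
  by congr (_ + _); ring.
under eq_bigr => i _ do rewrite /= E.
by rewrite big_split /= -mulr_suml -mulr_sumr r2pE.
Qed.

Lemma iter_lap_mderiv (i : nat) (l : 'I_n) f :
  iter i (@lap R n) f^`M(l) = (iter i (@lap R n) f)^`M(l).
Proof.
elim: i => //= i ->; rewrite /lap linear_sum; apply: eq_bigr => j _ /=.
by rewrite [X in _ = X]mderiv_comm [X in _ = X^`M(_)]mderiv_comm.
Qed.

Lemma euler_iter_lap (x : 'I_n -> R) d (i : nat) f : f \is d.-homog ->
  \sum_l x l * (iter i (@lap R n) f^`M(l)).@[x] =
  (d - i.*2)%:R * (iter i (@lap R n) f).@[x].
Proof.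
move=> hf; have := congr1 (meval x) (euler (iter_lap_homog i hf)).
rewrite mevalZ raddf_sum => <-; apply: eq_bigr => l _ /=.
by rewrite mevalM mevalXU iter_lap_mderiv.
Qed.

Definition bq (i : nat) : R := (2 ^+ i * i`!%:R)^-1.

Lemma bqS (i : nat) : bq i = 2 * i.+1%:R * bq i.+1.
Proof.
rewrite /bq exprS factS natrM; field.
by rewrite ?expf_neq0 ?pnatr_eq0 -?lt0n ?fact_gt0 //= nat1r pnatr_eq0.
Qed.

(** One term of the expansion of E[f(V) exp<x,V>] = exp(|x|^2/2) (exp(Delta/2) f)(x). The boolean
    factor selects the part of degree p in x, since |x|^(2j) Delta^i f has degree 2j + d - 2i. *)
Definition Gterm (x : 'I_n -> R) (d p : nat) f (i j : nat) : R :=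
  (d + j.*2 == p + i.*2)%N%:R * (bq i * bq j) *
  ((iter i (@lap R n) f).@[x] * (r2p R n).@[x] ^+ j).

Lemma G_const f : f \is 0.-homog -> forall x, G f = f.@[x].
Proof.
move=> hf x; rewrite (mpolyE f) linear_sum raddf_sum big_seq [RHS]big_seq.
apply: eq_bigr => m hm /=; have := dhomog_mf hf hm => /eqP; rewrite mdeg_eq0 => /eqP ->.
by rewrite mpolyX0 GZ G1 mevalZ meval1.
Qed.

(** Base case p = 0: an index j > 0 would force 2i > d, where Delta^i f = 0. What remains is i = d/2
    for even d and nothing for odd d. *)
Lemma G_linp0 x (d : nat) f B : f \is d.-homog -> (d <= N)%N -> (d < B)%N ->
  G f = \sum_(i < B) \sum_(j < B) Gterm x d 0 f i j.
Proof.
move=> hf hN hB.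
have -> : \sum_(i < B) \sum_(j < B) Gterm x d 0 f i j =
   \sum_(i < B) (d == i.*2)%N%:R * bq i * (iter i (@lap R n) f).@[x].
  apply: eq_bigr => i _; have B0 : (0 < B)%N by lia.
  rewrite (bigD1 (Ordinal B0)) //= big1 ?addr0 => [|j hj].
    by rewrite /Gterm /= double0 addn0 add0n /bq !expr0 fact0 !mulr1 invr1 mulr1.
  rewrite /Gterm add0n; case: eqP => [hd|_]; last by rewrite !mul0r.
  rewrite (iter_lap_big _ hf) ?meval0 ?mul0r ?mulr0 //.
  have : (j : nat) != 0%N by apply: contra hj => /eqP h; apply/eqP/val_inj.
  by lia.
have [od|ed] := boolP (odd d).
  rewrite big1 => [|i _]; last first.
    by case: eqP => [hd|_]; rewrite ?mul0r //; rewrite hd odd_double in od.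
  (* For odd d, [G_lap] reduces the degree by two until it is 1, where the Laplacian vanishes; the
     factors d - 2 met on the way are nonzero by parity. *)
  have key : d%:R * G f = 0.
    rewrite -(G_lap hf hN).
    elim/ltn_ind: d f hf od hN hB => d IH f hf od hN hB.
    have hl := lap_homog hf.
    have [d2|d2] := ltnP d 2; first by rewrite (lap_homog_small d2 hf) linear0.
    have := IH (d - 2)%N _ _ hl; rewrite (G_lap hl) => [h|]; last by lia.
    have h0 : (d - 2)%:R * G (lap f) = 0 by apply: h; lia.
    by apply/eqP; move/eqP: h0; rewrite mulf_eq0 pnatr_eq0 => /orP[|//]; lia.
  by apply/eqP; move/eqP: key; rewrite mulf_eq0 pnatr_eq0 => /orP[|//]; lia.
have hd2 : d = d./2.*2 by rewrite -[LHS]odd_double_half (negbTE ed).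
have hB2 : (d./2 < B)%N by lia.
rewrite (bigD1 (Ordinal hB2)) //= big1 ?addr0 => [|i hi]; last first.
  case: eqP => [h|_]; rewrite ?mul0r //.
  case/negP: hi; apply/eqP/val_inj => /=; lia.
rewrite -hd2 eqxx mul1r.
move: hd2 hf hN; move: d./2 => k -> {d ed hB hB2}.
elim: k f => [|k IH] f hf hN.
  by rewrite /= /bq expr0 fact0 mulr1 invr1 mul1r; apply: G_const.
have hl : lap f \is (k.*2).-homog by have := lap_homog hf; rewrite doubleS -addn2 addnK.
have := IH _ hl; rewrite -iterSr => /(_ ltac:(lia)); rewrite (G_lap hf hN) bqS => h.
have k0 : (k.+1.*2)%:R != 0 :> R by rewrite pnatr_eq0.
apply: (mulfI k0); rewrite h -muln2 natrM; ring.
Qed.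

(** Both sides obey the recursion [G_linpS]. In the double sum the gradient term contributes the
    weight d - 2i, by Euler, and the r^2 term the weight 2j; their sum is p + 1 on the selected
    indices. Any [B] beyond the degrees will do, as the terms with 2i > d vanish. *)
Lemma G_linp x (d p : nat) f B : f \is d.-homog -> (d + p <= N)%N -> (d + p < B)%N ->
  G (f * linp x ^+ p) =
  p`!%:R * \sum_(i < B) \sum_(j < B) Gterm x d p f i j.
Proof.
elim/ltn_ind: p d f => p IH d f hf hN hB.
case: p IH hN hB => [|p] IH hN hB.
  by rewrite expr0 mulr1 fact0 mul1r; apply: G_linp0; rewrite // ?addn0 in hN hB *.
rewrite (G_linpS _ hf) //.
have -> : \sum_i x i * G (f^`M(i) * linp x ^+ p) = p`!%:R *
    \sum_(i < B) \sum_(j < B) (d - i.*2)%:R * Gterm x d p.+1 f i j.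
  case: d hf hN hB => [|d] hf hN hB.
    rewrite !big1 ?mulr0 // => i _; last by rewrite (mderiv_homog0 i hf) mul0r linear0 mulr0.
    by rewrite big1 // => j _; rewrite mul0r.
  have E (l : 'I_n) : x l * G (f^`M(l) * linp x ^+ p) = p`!%:R *
     \sum_(i < B) \sum_(j < B) (d + j.*2 == p + i.*2)%N%:R * (bq i * bq j) *
       (r2p R n).@[x] ^+ j * (x l * (iter i (@lap R n) f^`M(l)).@[x]).
    rewrite (IH p _ d) //; [|exact: mderiv_homog hf|lia|lia].
    rewrite mulrCA mulr_sumr; congr (_ * _); apply: eq_bigr => i _.
    by rewrite mulr_sumr; apply: eq_bigr => j _; rewrite /Gterm; ring.
  under eq_bigr => l _ do rewrite E.
  rewrite -mulr_sumr exchange_big; congr (_ * _); apply: eq_bigr => i _ /=.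
  rewrite exchange_big; apply: eq_bigr => j _ /=.
  rewrite -mulr_sumr (euler_iter_lap _ _ hf) /Gterm !addSn eqSS; ring.
have -> : p%:R * (r2p R n).@[x] * G (f * linp x ^+ p.-1) = p`!%:R *
    \sum_(i < B) \sum_(j < B) (j.*2)%:R * Gterm x d p.+1 f i j.
  case: p IH hN hB => [|p] IH hN hB.
    rewrite !mul0r fact0 mul1r big1 // => i _; rewrite big1 // => j _.
    rewrite /Gterm; case: eqP => [h|_]; last by rewrite !(mul0r, mulr0).
    case: (posnP j) => [->|j0]; first by rewrite mul0r.
    by rewrite (iter_lap_big _ hf) ?meval0 ?mul0r ?mulr0 //; lia.
  rewrite (IH p _ d) //; [|lia|lia].
  rewrite factS natrM -!mulrA; congr (_ * _); rewrite mulrCA; congr (_ * _).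
  rewrite mulr_sumr; apply: eq_bigr => i _; rewrite mulr_sumr.
  (* Shift j by one, using b_j = 2 (j + 1) b_(j+1). The first index on the right has factor 0, and
     the last one on the left forces 2i > d. *)
  clear IH; case: B hB i => // B hB i.
  rewrite [RHS]big_ord_recl /= mul0r add0r big_ord_recr /=.
  rewrite [X in _ + X = _](_ : _ = 0) ?addr0; last first.
    rewrite /Gterm; case: eqP => [h|_]; last by rewrite !(mul0r, mulr0).
    by rewrite (iter_lap_big _ hf) ?meval0 ?mul0r ?mulr0 //; lia.
  apply: eq_bigr => j _; rewrite /Gterm /= /bump add1n.
  have -> : (d + j.+1.*2 == p.+2 + i.*2)%N = (d + j.*2 == p + i.*2)%N by lia.
  have hj : (j.+1.*2)%:R = 2 * j.+1%:R :> R by rewrite -muln2 natrM mulrC.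
  by rewrite [bq j]bqS exprS hj; ring.
rewrite -mulrDr factS natrM [_.+1%:R * _]mulrC -mulrA; congr (_ * _).
rewrite -big_split mulr_sumr; apply: eq_bigr => i _ /=.
rewrite -big_split mulr_sumr; apply: eq_bigr => j _ /=.
(* The weights add up to d - 2i + 2j = p + 1; the subtraction is genuine unless Delta^i f = 0. *)
rewrite -mulrDl -natrD /Gterm; case: eqP => [h|_]; last by rewrite !(mul0r, mulr0).
have [d2|d2] := ltnP d i.*2; first by rewrite (iter_lap_big d2 hf) ?meval0 ?mul0r ?mulr0.
by congr (_%:R * _); lia.
Qed.

Definition acoef (k m i : nat) : R := bq i * bq (m - k + i).

Definition Lam (k m : nat) f : {mpoly R[n]} :=
  \sum_(i < k.+1) acoef k m i *: r2lap i f.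

Lemma meval_Lam x k m f :
  (Lam k m f).@[x] = \sum_(i < k.+1) acoef k m i * (r2lap i f).@[x].
Proof. by rewrite /Lam raddf_sum; apply: eq_bigr => i _; rewrite /= mevalZ. Qed.

(** For degrees 2k and 2m the selected pairs are exactly j = m - k + i, so r^(2(m-k)) factors out of
    every term. *)
Lemma G_linp_even x (k m : nat) f : f \is (k.*2).-homog -> (k <= m)%N ->
  (k.*2 + m.*2 <= N)%N ->
  G (f * linp x ^+ m.*2) =
  (m.*2)`!%:R * ((r2p R n).@[x] ^+ (m - k) * (Lam k m f).@[x]).
Proof.
move=> hf hkm hN; rewrite (G_linp x hf hN (ltnSn _)); congr (_ * _).
have hB : (k.+1 <= (k.*2 + m.*2).+1)%N by lia.
rewrite (bigID (fun i : 'I_(k.*2 + m.*2).+1 => (i < k.+1)%N)) /= [X in _ + X]big1 ?addr0; last first.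
  move=> i hi; rewrite big1 // => j _.
  by rewrite /Gterm (iter_lap_big _ hf) ?meval0 ?mul0r ?mulr0 //; lia.
rewrite -(big_ord_widen _ (fun i => \sum_(j < (k.*2 + m.*2).+1) Gterm x k.*2 m.*2 f i j) hB).
rewrite meval_Lam mulr_sumr; apply: eq_bigr => i _ /=.
have hj : (m - k + i < (k.*2 + m.*2).+1)%N by have := ltn_ord i; lia.
rewrite (bigD1 (Ordinal hj)) //= big1 ?addr0 => [|j hj']; last first.
  rewrite /Gterm; case: eqP => [h|_]; last by rewrite !(mul0r, mulr0).
  case/negP: hj'; apply/eqP/val_inj => /=; lia.
rewrite /Gterm.
have -> : (k.*2 + (m - k + i).*2 == m.*2 + i.*2)%N by lia.
by rewrite /r2lap mevalM rmorphXn /= exprD /acoef; ring.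
Qed.

End Stein.
End Forms.

(** * Gaussian quadrature *)

Module Quadrature.
Import complex.
Section HermiteQuadrature.
Variable R : rcfType.

(** The spectral measure of [J] at the first basis vector: if P is unitary and diagonalizes [J], the
    atoms are the eigenvalues and the weights are |P_(j0)|^2. The diagonalization takes place over
    R[i], and both families are then seen to be real. *)
Lemma symmetric_moments N (J : 'M[R]_N.+1) : J^T = J ->
  exists t w : 'I_N.+1 -> R, (forall j, 0 <= w j) /\
    forall q, (J ^+ q) 0 0 = \sum_j w j * t j ^+ q.
Proof.
move=> symJ; pose rc := real_complex R.
pose A : 'M[R[i]]_N.+1 := map_mx rc J.
have hA : A \is hermsymmx.
  apply/is_hermitianmxP; rewrite expr0 scale1r; apply/matrixP => i j.
  by rewrite !mxE -{1}symJ mxE; symmetry; apply: conjc_real.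
have /orthomx_spectralP EA := hermitian_normalmx hA.
have uP := spectral_unitarymx A.
have unitP := spectral_unit A.
have rsp : spectral_diag A \is a realmx by apply: hermitian_spectral_diag_real.
move: (spectralmx A) (spectral_diag A) EA uP unitP rsp => P sp EA uP unitP rsp.
have EAq q : A ^+ q = invmx P *m diag_mx (\row_j sp 0 j ^+ q) *m P.
  elim: q => [|q IH].
    rewrite expr0 (_ : diag_mx _ = 1%:M) ?mulmx1 ?mulVmx //.
    by apply/matrixP => i j; rewrite !mxE expr0.
  have -> : A ^+ q.+1 = A *m A ^+ q by rewrite exprS.
  rewrite IH [X in X *m _ = _]EA !mulmxA (mulmxK unitP); congr (_ *m _).
  rewrite -!mulmxA; congr (_ *m _); apply/matrixP => i j.
  by rewrite mul_diag_mx !mxE exprS; case: eqP => [->|_]; rewrite ?mulr1n ?mulr0n ?mulr0.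
have [w [w0 hw]] : exists w : 'I_N.+1 -> R, (forall j, 0 <= w j) /\
    forall j, (w j)%:C%C = `|P j 0| ^+ 2.
  exists (fun j => complex.Re (`|P j 0| ^+ 2)); split=> j.
    have : 0 <= `|P j 0| ^+ 2 by apply: exprn_ge0.
    by rewrite lecE => /andP[].
  by have /complex_realP [x ->] : `|P j 0| ^+ 2 \is Num.real
    by apply: rpredX; apply: normr_real.
have [t ht] : exists t : 'I_N.+1 -> R, forall j, (t j)%:C%C = sp 0 j.
  exists (fun j => complex.Re (sp 0 j)) => j.
  by move/mxOverP: rsp => /(_ 0 j) /complex_realP [x ->].
exists t, w; split=> // q; apply: (@complexI R); rewrite rmorph_sum /=.
have -> : ((J ^+ q) 0 0)%:C%C = (A ^+ q) 0 0.
  by rewrite /A -rmorphXn /= mxE.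
rewrite EAq mxE; apply: eq_bigr => j _.
rewrite rmorphM rmorphXn /= ht hw.
by rewrite mul_mx_diag !mxE (invmx_unitary uP) !mxE mulrAC -[_ * P j 0]mulrC -normCK.
Qed.

(** The moments of the standard normal law: (q - 1)!! for even q and 0 for odd q. *)
Fixpoint mu (q : nat) : nat :=
  match q with 0 => 1 | 1 => 0 | q.+2 => q.+1 * mu q end%N.

Lemma muS q : mu q.+1 = (q * mu q.-1)%N.
Proof. by case: q. Qed.

(** The truncated Jacobi matrix of the normalized Hermite polynomials, from x h_j = sqrt(j+1)
    h_(j+1) + sqrt(j) h_(j-1). *)
Definition jac N : 'M[R]_N.+1 := \matrix_(i, j)
  ((i.+1 == j :> nat)%:R * Num.sqrt j%:R + (j.+1 == i :> nat)%:R * Num.sqrt i%:R).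

(** The right side is E[x^q h_i] for a standard normal x. A walk of at most N steps from 0 never
    feels the truncation at N, whence the bound on q. *)
Lemma jac_row N q (i : 'I_N.+1) : (q <= N)%N ->
  (jac N ^+ q) 0 i = Num.sqrt (i`!)%:R * 'C(q, i)%:R * (mu (q - i))%:R.
Proof.
elim: q i => [|q IH] i hq.
  rewrite expr0 mxE; case: i => [[|i] hi] //=.
    by rewrite fact0 bin0 sqrtr1 !mulr1.
  by rewrite bin0n mulr0 mul0r.
pose a (l : nat) : R := Num.sqrt (l`!)%:R * 'C(q, l)%:R * (mu (q - l))%:R.
rewrite exprSr -[_ * _]/(_ *m _) mxE.
have E (l : 'I_N.+1) : (jac N ^+ q) 0 l * jac N l i =
   (l.+1 == i :> nat)%:R * (a l * Num.sqrt i%:R)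
   + (l == i.+1 :> nat)%:R * (a l * Num.sqrt l%:R).
  by rewrite IH ?mxE 1?ltnW // -/(a l) eq_sym [_ == l :> nat]eq_sym; ring.
under eq_bigr => l _ do rewrite E.
rewrite big_split /=.
have -> : \sum_(l < N.+1) (l == i.+1 :> nat)%:R * (a l * Num.sqrt l%:R) = a i.+1 * Num.sqrt i.+1%:R.
  have [hi|hi] := ltnP i.+1 N.+1.
    rewrite (bigD1 (Ordinal hi)) //= eqxx mul1r big1 ?addr0 // => l hl.
    case: eqP => [h|_]; last by rewrite mul0r.
    by case/eqP: hl; apply/val_inj.
  (* At the edge of the matrix the missing neighbour i + 1 exceeds q, so its binomial coefficient is
     zero. *)
  have -> : a i.+1 = 0 by rewrite /a bin_small ?mulr0 ?mul0r // (leq_trans hq (ltnW hi)).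
  rewrite mul0r big1 //.
  move=> l _; case: eqP => [h|_]; last by rewrite mul0r.
  by have := ltn_ord l; rewrite h ltnNge hi.
have -> : \sum_(l < N.+1) (l.+1 == i :> nat)%:R * (a l * Num.sqrt i%:R) =
   (0 < i)%N%:R * (a i.-1 * Num.sqrt i%:R).
  case: i {E} => [[|i] hi] /=.
    by rewrite big1 ?mul0r // => l _; rewrite mul0r.
  have hi' : (i < N.+1)%N by apply: ltnW.
  rewrite (bigD1 (Ordinal hi')) //= eqxx !mul1r big1 ?addr0 // => l hl.
  case: eqP => [[h]|_]; last by rewrite mul0r.
  by case/eqP: hl; apply/val_inj.
have S1 (l : nat) : Num.sqrt (l`!)%:R * Num.sqrt (l.+1)%:R = Num.sqrt (l.+1`!)%:R :> R.
  by rewrite -sqrtrM ?ler0n // -natrM mulnC factS.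
have S2 : a i.+1 * Num.sqrt i.+1%:R = Num.sqrt (i`!)%:R * (i.+1 * 'C(q, i.+1) * mu (q - i.+1))%N%:R.
  rewrite /a -S1; have := sqr_sqrtr (ler0n R i.+1); rewrite expr2 !natrM => h.
  by rewrite -[X in _ = _ * (X * _ * _)]h; ring.
rewrite S2 {S2}.
(* This combines (i+1) C(q,i+1) = (q-i) C(q,i) with the moment recursion [muS]. *)
have hb : (i.+1 * 'C(q, i.+1) * mu (q - i.+1) = 'C(q, i) * mu (q.+1 - i))%N.
  rewrite mul_bin_left; have [hi|hi] := leqP i q; last by rewrite bin_small // !mul0n muln0 mul0n.
  by rewrite subSn // muS subnS mulnA [('C(q, i) * _)%N]mulnC.
rewrite hb {hb E}; case: i => [[|i] hi] /=.
  by rewrite mul0r add0r ?subn0 !bin0 mul1n mulr1.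
rewrite mul1r /a mulrAC [_ * _ * Num.sqrt _]mulrAC S1 subSS binS natrD natrM.
by ring.
Qed.

Lemma gauss_quadrature N : exists t w : 'I_N.+1 -> R, (forall j, 0 <= w j) /\
  forall q, (q <= N)%N -> \sum_j w j * t j ^+ q = (mu q)%:R.
Proof.
have [|t [w [w0 h]]] := @symmetric_moments N (jac N).
  by apply/matrixP => i j; rewrite !mxE addrC.
exists t, w; split=> // q hq; rewrite -h jac_row //.
by rewrite fact0 bin0 sqrtr1 !mul1r subn0.
Qed.
End HermiteQuadrature.
End Quadrature.

Module Gauss.
Import mpoly Forms Quadrature.
Section GaussianFunctional.
Variables (R : rcfType) (n N : nat).

(** The tensor product of n copies of the one-dimensional rule. Moments of monomials factor over the
    coordinates, so Stein's identity reduces to [muS] in coordinate i. *)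
Lemma gauss_functional : exists (I : finType) (W : I -> R) (t : I -> 'I_n -> R),
  [/\ (forall v, 0 <= W v),
      \sum_v W v * (1 : {mpoly R[n]}).@[t v] = 1 &
      forall (i : 'I_n) d (g : {mpoly R[n]}), g \is d.-homog -> (d < N)%N ->
        \sum_v W v * ('X_i * g).@[t v] = \sum_v W v * (g^`M(i)).@[t v]].
Proof.
have [t [w [w0 hw]]] := gauss_quadrature R N.
pose W (v : {ffun 'I_n -> 'I_N.+1}) := \prod_i w (v i).
pose T (v : {ffun 'I_n -> 'I_N.+1}) i := t (v i).
have GX (m : 'X_{1..n}) : (mdeg m <= N)%N ->
    \sum_v W v * ('X_[m] : {mpoly R[n]}).@[T v] = \prod_i (mu (m i))%:R.
  move=> hm.
  have E (i : 'I_n) : (mu (m i))%:R = \sum_j w j * t j ^+ (m i).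
    rewrite hw // (leq_trans _ hm) // mdegE (bigD1 i) //=; exact: leq_addr.
  under [RHS]eq_bigr => i _ do rewrite E.
  rewrite bigA_distr_bigA /=; apply: eq_bigr => v _.
  by rewrite mevalX -big_split.
exists {ffun 'I_n -> 'I_N.+1}, W, T; split.
- by move=> v; apply: prodr_ge0.
- by rewrite -mpolyX0 GX ?mdeg0 // big1 // => i _; rewrite mnm0E.
move=> i d g hg hd.
apply: (@homog_eq_linear R n R^o (fun g => \sum_v W v * ('X_i * g).@[T v])
  (fun g => \sum_v W v * (g^`M(i)).@[T v]) _ _ _ _ hg).
- move=> a p q; rewrite scaler_sumr -big_split /=; apply: eq_bigr => v _.
  by rewrite mulrDr -scalerAr mevalD mevalZ mulrDr mulrCA.
- move=> a p q; rewrite scaler_sumr -big_split /=; apply: eq_bigr => v _.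
  by rewrite mderivD mderivZ mevalD mevalZ mulrDr mulrCA.
move=> m hm; rewrite mderivX -mpolyXD GX; last by rewrite mdegD mdeg1 hm.
have -> : \sum_v W v * ((m i)%:R *: ('X_[m - U_(i)] : {mpoly R[n]})).@[T v] =
   (m i)%:R * \sum_v W v * ('X_[m - U_(i)] : {mpoly R[n]}).@[T v].
  by rewrite mulr_sumr; apply: eq_bigr => v _; rewrite mevalZ mulrCA.
rewrite GX; last by rewrite (leq_trans (mdegB _ _)) // hm ltnW.
rewrite (bigD1 i) //= [in RHS](bigD1 i) //= mulrA mnmDE mnm1E eqxx add1n muS natrM.
congr (_ * _); first by rewrite mnmBE mnm1E eqxx subn1.
by apply: eq_bigr => j hj; rewrite mnmDE mnmBE mnm1E eq_sym (negbTE hj) add0n subn0.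
Qed.
End GaussianFunctional.
End Gauss.

(** * Determinant bound and constants *)

Section DeterminantBound.
Variable R : realFieldType.

(** The product of the matrices E - eps_l for l < i. The recursion makes sense for every size,
    including 0, as needed for matrices indexed by the cardinal of a finite type. *)
Fixpoint chain N (E : 'M[R]_N) (eps : nat -> R) (i : nat) : 'M[R]_N :=
  if i is i'.+1 then E *m chain E eps i' - eps i' *: chain E eps i' else 1%:M.

Definition chain_poly (eps : nat -> R) i := \prod_(l < i) ('X - (eps l)%:P).

Lemma chainE N (E : 'M[R]_N.+1) eps i : chain E eps i = horner_mx E (chain_poly eps i).
Proof.
elim: i => [|i IH]; first by rewrite /chain_poly big_ord0 rmorph1.
rewrite /chain_poly big_ord_recr /= -/(chain_poly eps i) mulrC rmorphM /= -IH.
by rewrite rmorphB /= horner_mx_X horner_mx_C mulrBl /= -mul_scalar_mx.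
Qed.

(** E is annihilated by a polynomial with distinct roots, hence diagonalizable with spectrum among
    eps_0, ..., eps_K. At the eigenvalue eps_s the sum equals a_0 plus terms that contain the factor
    eps_s - eps_s when i > s and are products of nonnegative numbers when i <= s. So each eigenvalue
    is at least a_0, and the determinant at least a_0^N. *)
Lemma chain_det N (E : 'M[R]_N) (eps a : nat -> R) K :
  (forall i j, (i < j)%N -> (j <= K)%N -> eps i < eps j) ->
  (forall i, 0 <= a i) ->
  chain E eps K.+1 = 0 ->
  a 0%N ^+ N <= \det (\sum_(i < K.+1) a i *: chain E eps i).
Proof.
case: N E => [|N] E hinc ha hE; first by rewrite det_mx00 expr0.
have uE : uniq [seq eps l | l <- iota 0 K.+1].
  rewrite map_inj_in_uniq ?iota_uniq // => i j; rewrite !mem_iota !add0n !ltnS /=.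
  move=> hi hj hij; apply/eqP; case: (ltngtP i j) => // h.
    by have := hinc _ _ h hj; rewrite hij ltxx.
  by have := hinc _ _ h hi; rewrite hij ltxx.
have pE : chain_poly eps K.+1 = \prod_(x <- [seq eps l | l <- iota 0 K.+1]) ('X - x%:P).
  by rewrite /chain_poly -(big_mkord xpredT (fun l => 'X - (eps l)%:P)) big_map /index_iota subn0.
have hp0 : horner_mx E (chain_poly eps K.+1) = 0 by rewrite -chainE.
have : diagonalizable E.
  apply/diagonalizableP; exists [seq eps l | l <- iota 0 K.+1] => //.
  by rewrite -pE; apply/mxminpoly_minP.
case=> P uP /(diagonalizable_forLR uP) [D ED].
have ED' : E = invmx P *m diag_mx D *m P by rewrite ED; apply: conjVmx.
have hC p : horner_mx E p = invmx P *m diag_mx (\row_j p.[D 0 j]) *m P.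
  rewrite ED' horner_mx_uconjC // horner_mx_diag; congr (_ *m _ *m _).
  by congr diag_mx; apply/rowP => j; rewrite !mxE.
have hD j : exists2 s, (s <= K)%N & D 0 j = eps s.
  have : diag_mx (\row_j (chain_poly eps K.+1).[D 0 j]) = 0.
    move: hp0; rewrite hC => /(congr1 (fun X => P *m X *m invmx P)).
    by rewrite !mulmxA mulmxV // mul1mx mulmxK // mulmx0 mul0mx.
  move/matrixP => /(_ j j); rewrite !mxE eqxx mulr1n pE => /eqP.
  rewrite -/(root _ _) root_prod_XsubC => /mapP [s].
  by rewrite mem_iota add0n ltnS /= => hs ->; exists s.
pose p := \sum_(i < K.+1) a i *: chain_poly eps i.
have -> : \sum_(i < K.+1) a i *: chain E eps i = horner_mx E p.
  by rewrite linear_sum; apply: eq_bigr => i _; rewrite linearZ chainE.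
rewrite hC !det_mulmx mulrAC -det_mulmx mulVmx // det1 mul1r det_diag.
rewrite -[X in _ ^+ X]card_ord -prodr_const; apply: ler_prod => j _.
rewrite ha /= mxE; have [s hs ->] := hD j.
rewrite horner_sum big_ord_recl /= hornerZ /chain_poly big_ord0 hornerC mulr1 lerDl.
apply: sumr_ge0 => i _; rewrite hornerZ mulr_ge0 // horner_prod.
have [si|si] := ltnP s (bump 0 i).
  by rewrite (bigD1 (Ordinal si)) //= hornerXsubC subrr mul0r.
apply: prodr_ge0 => l _; rewrite hornerXsubC subr_ge0 ltW //.
by apply: hinc => //; apply: leq_trans si.
Qed.
End DeterminantBound.

(** * Falling factorials and the value of c_0 *)

Section Constants.
Variable R : realFieldType.

Definition falling (x : R) i := \prod_(l < i) (x - l%:R).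

Lemma fallingS x i : falling x i.+1 = falling x i * (x - i%:R).
Proof. by rewrite /falling big_ord_recr. Qed.

(** Split x + y - k as (x - i) + (y - (k - i)) to extend one of the two falling factorials, then use
    Pascal's rule. *)
Lemma falling_vandermonde x y k :
  \sum_(i < k.+1) 'C(k, i)%:R * (falling x i * falling y (k - i)) = falling (x + y) k.
Proof.
elim: k => [|k IH]; first by rewrite big_ord_recl big_ord0 /falling !big_ord0 bin0 !mulr1 addr0.
rewrite fallingS -IH mulr_suml.
have E (i : 'I_k.+1) : 'C(k, i)%:R * (falling x i * falling y (k - i)) * (x + y - k%:R) =
   'C(k, i)%:R * (falling x i.+1 * falling y (k - i))
   + 'C(k, i)%:R * (falling x i * falling y (k.+1 - i)).
  have hi : (i <= k)%N by rewrite -ltnS.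
  by rewrite subSn // !fallingS natrB //; ring.
under [RHS]eq_bigr => i _ do rewrite E.
rewrite big_split /= big_ord_recl /= bin0 subn0 [X in _ = _ + X]big_ord_recl /= bin0 subn0.
rewrite addrCA; congr (_ + _); rewrite big_ord_recr /= [in RHS]big_ord_recr /=.
rewrite /bump !add1n !subnn !binn addrAC; congr (_ + _).
rewrite -big_split; apply: eq_bigr => i _ /=.
by rewrite /bump !add1n binS natrD subSS; ring.
Qed.

Lemma falling_natE m i : (i <= m)%N -> falling m%:R i = (m`!)%:R / ((m - i)`!)%:R.
Proof.
move=> him; rewrite -(ffact_fact him) natrM mulfK ?pnatr_eq0 -?lt0n ?fact_gt0 //.
elim: i him => [|i IH] hi; first by rewrite /falling big_ord0 ffactn0.
by rewrite fallingS IH ?ffactnSr ?natrM ?natrB // ltnW.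
Qed.

Lemma epsl_diff n k l : (l <= k)%N ->
  Forms.epsl R n k k - Forms.epsl R n k l = 4 * (k - l)%:R * (k%:R - 1 + n%:R / 2 - l%:R).
Proof. by move=> hl; rewrite /Forms.epsl natrB //; field. Qed.

(** The difference is 2 (j - i) (2 (k - j) + 2 (k - i) + n - 2), where k - i > 0 and n >= 2. *)
Lemma epsl_lt n k i j : (1 < n)%N -> (i < j)%N -> (j <= k)%N ->
  Forms.epsl R n k i < Forms.epsl R n k j.
Proof.
move=> n2 ij jk; rewrite /Forms.epsl.
have h1 : (i%:R : R) < j%:R by rewrite ltr_nat.
have h2 : (j%:R : R) <= k%:R by rewrite ler_nat.
have h3 : (2 : R) <= n%:R by rewrite ler_nat.
have h0 : (0 : R) <= i%:R by rewrite ler0n.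
have -> : 2 * j%:R * (4 * k%:R - 2 * j%:R + n%:R - 2) =
  2 * i%:R * (4 * k%:R - 2 * i%:R + n%:R - 2)
  + 2 * (j%:R - i%:R) * (2 * (k%:R - j%:R) + 2 * (k%:R - i%:R) + (n%:R - 2)) :> R by ring.
rewrite ltrDl; apply: mulr_gt0; lra.
Qed.

(** The eigenvalue of [L] on r^(2k), which is also its factor on spherical means. *)
Definition c0const n k m : R :=
  \sum_(i < k.+1) Forms.acoef R k m i *
    \prod_(l < i) (Forms.epsl R n k k - Forms.epsl R n k l).

Lemma prod_epsl_diff n k i : (i <= k)%N ->
  \prod_(l < i) (Forms.epsl R n k k - Forms.epsl R n k l) =
  4 ^+ i * (k ^_ i)%:R * falling (k%:R - 1 + n%:R / 2) i.
Proof.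
elim: i => [|i IH] hi; first by rewrite big_ord0 /falling big_ord0 ffactn0 !mulr1.
rewrite big_ord_recr /= IH ?(ltnW hi) // epsl_diff ?(ltnW hi) //.
by rewrite fallingS ffactnSr natrM exprSr; ring.
Qed.

(** By [prod_epsl_diff] the powers of 2 other than 2^(m-k) cancel, k^_i / i! is a binomial
    coefficient, and 1 / (m-k+i)! is the falling factorial of m of length k - i divided by m!. The
    sum is then Chu-Vandermonde at k - 1 + n/2 and m. *)
Lemma c0constE n k m : (k <= m)%N ->
  c0const n k m = falling (m%:R + k%:R - 1 + n%:R / 2) k / (2 ^+ (m - k) * (m`!)%:R).
Proof.
move=> hkm; have m0 : (m`!)%:R != 0 :> R by rewrite pnatr_eq0 -lt0n fact_gt0.
have p0 i : 2 ^+ i != 0 :> R by rewrite expf_neq0 // pnatr_eq0.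
have -> : m%:R + k%:R - 1 + n%:R / 2 = (k%:R - 1 + n%:R / 2) + m%:R :> R by ring.
rewrite -falling_vandermonde mulr_suml; apply: eq_bigr => i _.
have hi : (i <= k)%N by rewrite -ltnS.
rewrite prod_epsl_diff // falling_natE; last by lia.
rewrite /Forms.acoef /Forms.bq -(bin_ffact k i) natrM.
have -> : (m - (k - i) = m - k + i)%N by lia.
have f0 j : (j`!)%:R != 0 :> R by rewrite pnatr_eq0 -lt0n fact_gt0.
have -> : 4 ^+ i = 2 ^+ i * 2 ^+ i :> R by rewrite -exprMn_comm; [congr (_ ^+ _); ring|exact: mulrC].
rewrite exprD; field.
by rewrite !p0 !f0.
Qed.

Lemma acoef_gt0 k m i : 0 < Forms.acoef R k m i.
Proof.
by rewrite /Forms.acoef /Forms.bq mulr_gt0 // invr_gt0 mulr_gt0 ?exprn_gt0 ?ltr0n ?fact_gt0.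
Qed.

Lemma falling_gt0 n k m : (1 < n)%N -> 0 < falling (m%:R + k%:R - 1 + n%:R / 2) k.
Proof.
move=> n2; apply: prodr_gt0 => l _; have hl := ltn_ord l.
have h1 : (l%:R : R) + 1 <= k%:R by rewrite natr1 ler_nat.
have h3 : (2 : R) <= n%:R by rewrite ler_nat.
have h0 : (0 : R) <= m%:R by rewrite ler0n.
by lra.
Qed.

Lemma ratioE n k m : (1 < n)%N -> (k <= m)%N ->
  Forms.acoef R k m 0 / c0const n k m =
  (m`!)%:R / (((m - k)`!)%:R * falling (m%:R + k%:R - 1 + n%:R / 2) k).
Proof.
move=> n2 hkm; rewrite c0constE //.
have := falling_gt0 k m n2; move: (falling _ _) => F F0.
have f0 j : (j`!)%:R != 0 :> R by rewrite pnatr_eq0 -lt0n fact_gt0.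
rewrite /Forms.acoef /Forms.bq expr0 fact0 mulr1 invr1 mul1r addn0.
by field; rewrite !f0 gt_eqF //= expf_neq0 // pnatr_eq0.
Qed.
End Constants.

(** The recursion of [chain] for operators on functions; it serves both for coefficient vectors of
    forms and for coordinates on the hyperplane. *)
Fixpoint opchain (R : pzRingType) (J : Type) (E : (J -> R) -> J -> R)
    (eps : nat -> R) (i : nat) (u : J -> R) : J -> R :=
  if i is i'.+1 then
    fun j => E (opchain E eps i' u) j - eps i' * opchain E eps i' u j
  else u.

(** * The operators in coefficients *)

Module FormOps.
Import mpoly Forms Gauss.
Section Coefficients.
Variables (R : rcfType) (n d : nat).
Implicit Types (c : Mon n d -> R) (p : {mpoly R[n]}) (e : Mon n d).

Definition mmon e : 'X_{1..n} := [multinom (tnth (val e) i : nat) | i < n].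

Lemma mdeg_mmon e : mdeg (mmon e) = d.
Proof.
rewrite mdegE -[RHS](eqP (valP e)); apply: eq_bigr => i _; exact: mnmE.
Qed.

Lemma mmon_inj : injective mmon.
Proof.
move=> e e' h; apply/val_inj/eq_from_tnth => i; apply/val_inj => /=.
by have := congr1 (fun m : 'X_{1..n} => m i) h; rewrite !mnmE.
Qed.

Lemma mmon_surj (m : 'X_{1..n}) : mdeg m = d -> exists e, mmon e = m.
Proof.
move=> hm.
have hi (i : 'I_n) : (m i < d.+1)%N.
  by rewrite ltnS -hm mdegE (bigD1 i) //= leq_addr.
pose t : n.-tuple 'I_d.+1 := [tuple Ordinal (hi i) | i < n].
have ht : \sum_(i < n) (tnth t i : nat) == d.
  by rewrite -[X in _ == X]hm mdegE; apply/eqP; apply: eq_bigr => i _; rewrite tnth_mktuple.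
by exists (exist _ t ht); apply/mnmP => i; rewrite mnmE /= tnth_mktuple.
Qed.

Definition toP c : {mpoly R[n]} := \sum_e c e *: 'X_[mmon e].
Definition fromP p : Mon n d -> R := fun e => p@_(mmon e).

Lemma toP_homog c : toP c \is d.-homog.
Proof.
by apply: rpred_sum => e _; apply: dhomogZ; rewrite dhomogX /= mdeg_mmon.
Qed.

Lemma mcoeff_toP c e : (toP c)@_(mmon e) = c e.
Proof.
rewrite /toP raddf_sum (bigD1 e) //= mcoeffZ mcoeffX eqxx mulr1 big1 ?addr0 // => e' he.
by rewrite mcoeffZ mcoeffX (inj_eq mmon_inj) (negbTE he) mulr0.
Qed.

Lemma fromPK p : p \is d.-homog -> toP (fromP p) = p.
Proof.
move=> hp; apply/mpolyP => m.
have [/eqP hm|hm] := boolP (mdeg m == d); last first.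
  by rewrite !(@dhomog_nemf_coeff _ _ mdeg d) // toP_homog.
by have [e <-] := mmon_surj hm; rewrite mcoeff_toP.
Qed.

Lemma meval_toP c x : (toP c).@[x] = \sum_e c e * \prod_(i < n) x i ^+ tnth (val e) i.
Proof.
rewrite /toP (raddf_sum (meval x)); apply: eq_bigr => e _ /=.
rewrite mevalZ mevalX; congr (_ * _); apply: eq_bigr => i _.
by rewrite mnmE.
Qed.

End Coefficients.

Section Vanishing.
Variables (R : rcfType) (n : nat).
Implicit Types (p q : {mpoly R[n]}).

(** Nondegeneracy of the pairing G(p q). By parts, G(p_i q) = G(p X_i q) - G(p q_i) for derivatives
    p_i and q_i, so each derivative of p is again orthogonal to all forms q of degree below [B]. By
    induction the derivatives vanish, and Euler's identity gives p = 0. *)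
Lemma homog_eq0_stein N (G : {mpoly R[n]} -> R) : scalar G -> G 1 = 1 ->
  (forall i d g, g \is d.-homog -> (d < N)%N -> G ('X_i * g) = G (g^`M(i))) ->
  forall d B p, p \is d.-homog -> (d <= B)%N -> (d + B < N)%N ->
  (forall e q, (e <= B)%N -> q \is e.-homog -> G (p * q) = 0) -> p = 0.
Proof.
move=> linG G1 stein; elim=> [|d IH] B p hp dB dN h.
  have Ep : p = p@_0%MM *: 1.
    apply/mpolyP => m; rewrite mcoeffZ -mpolyC1 mcoeffC mul1r.
    have [->|m0] := eqVneq m 0%MM; first by rewrite mulr1.
    by rewrite mulr0 (dhomog_nemf_coeff hp) //= mdeg_eq0.
  have q1 : (1 : {mpoly R[n]}) \is 0.-homog by apply: dhomog1.
  have := h 0%N 1 (leq0n _) q1; rewrite mulr1 {1}Ep.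
  have := linG p@_0%MM 1 0; rewrite addr0 => -> ; rewrite G1.
  have -> : G 0 = 0.
    have := linG (-1) 0 0; by rewrite scaler0 addr0 mulN1r addNr.
  by rewrite addr0 /= mulr1 => p0; rewrite Ep p0 scale0r.
have hd i : p^`M(i) = 0.
  case: B dB dN h => // B dB dN h.
  apply: (IH B _ (mderiv_homog i hp)); [by []|by lia|].
  move=> e q he hq.
  have hpq : p * q \is (d.+1 + e).-homog by apply: dhomogM.
  have hXq : 'X_i * q \is e.+1.-homog.
    by apply: (@dhomogM _ _ _ 1%N) => //; rewrite dhomogX /= mdeg1.
  have e1 : G ((p * q)^`M(i)) = 0.
    rewrite -(stein _ _ _ hpq); last by lia.
    by rewrite mulrCA; apply: (h e.+1).
  have e2 : G (p * q^`M(i)) = 0.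
    apply: (h e.-1); first by lia.
    exact: mderiv_homog hq.
  move: e1; rewrite mderivM; have := linG 1 (p^`M(i) * q) (p * q^`M(i)).
  by rewrite !scale1r /= mul1r e2 addr0 => -> .
have := euler hp; rewrite big1 => [/esym/eqP|i _]; last by rewrite hd mulr0.
by rewrite scaler_eq0 pnatr_eq0 => /eqP.
Qed.

(** A form that vanishes at the nodes of a sufficiently exact rule is orthogonal to everything under
    the corresponding functional. *)
Lemma homog_eq0 d p : p \is d.-homog -> (forall x, p.@[x] = 0) -> p = 0.
Proof.
move=> hp h.
have [I [W [t [W0 G1 st]]]] := gauss_functional R n (d + d).+1.
have linG : scalar (fun p : {mpoly R[n]} => \sum_v W v * p.@[t v]).
  move=> a f g; rewrite /= mulr_sumr -big_split /=; apply: eq_bigr => v _.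
  by rewrite mevalD mevalZ mulrDr mulrCA.
apply: (homog_eq0_stein linG G1 st hp (leqnn d) (ltnSn _)) => e q _ _.
by rewrite big1 // => v _; rewrite mevalM h mul0r mulr0.
Qed.

End Vanishing.

Lemma r2p_lap_homog (R : realFieldType) n d (p : {mpoly R[n]}) :
  p \is d.-homog -> r2p R n * lap p \is d.-homog.
Proof.
move=> hp; have [d2|d2] := ltnP d 2; first by rewrite (lap_homog_small d2 hp) mulr0 dhomog0.
by rewrite -(subnKC d2); apply: dhomogM; [exact: r2p_homog | exact: lap_homog].
Qed.

(** * The operators E and L on coefficient vectors *)

Section Operator.
Variables (R : rcfType) (n k : nat).
Local Notation D := (Mon n k.*2 -> R).
Implicit Types (c : D) (x : 'I_n -> R).

(* [evr] and [r2r] are convertible to [ev] and [r2], but are available over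
   any real closed field. *)
Definition evr d (c : Mon n d -> R) x :=
  \sum_(e : Mon n d) c e * \prod_(i < n) x i ^+ tnth (val e) i.

Definition r2r x := \sum_(i < n) x i ^+ 2.

Definition Eop c : D := fromP (r2p R n * lap (toP c)).

Definition Lop m c : D :=
  fun e => \sum_(i < k.+1) acoef R k m i * opchain Eop (epsl R n k) i c e.

Lemma fromP_lin d (a : R) (p q : {mpoly R[n]}) :
  @fromP R n d (a *: p + q) = fun e => a * fromP p e + fromP q e.
Proof. by apply/funext => e; rewrite /fromP mcoeffD mcoeffZ. Qed.

Lemma toP_lin d (a : R) (c c' : Mon n d -> R) :
  toP (fun e => a * c e + c' e) = a *: toP c + toP c'.
Proof.
rewrite /toP scaler_sumr -big_split; apply: eq_bigr => e _ /=.
by rewrite scalerDl scalerA.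
Qed.

Lemma Eop_lin a c c' : Eop (fun e => a * c e + c' e) = fun e => a * Eop c e + Eop c' e.
Proof. by rewrite /Eop toP_lin linearP mulrDr -scalerAr fromP_lin. Qed.

Lemma toP_opchain i c : (i <= k.+1)%N ->
  toP (opchain Eop (epsl R n k) i c) = r2lap i (toP c).
Proof.
elim: i => [|i IH] hi; first by rewrite /r2lap expr0 mul1r.
have hr : r2lap i (toP c) \is (k.*2).-homog by apply: r2lap_homog => //; apply: toP_homog.
rewrite (r2lapS (hi : (i <= k)%N) (toP_homog c)).
have -> : opchain Eop (epsl R n k) i.+1 c =
   fun e => - epsl R n k i * opchain Eop (epsl R n k) i c e + Eop (opchain Eop (epsl R n k) i c) e.
  by apply/funext => e /=; ring.
rewrite toP_lin IH ?(ltnW hi) // /Eop fromPK; last exact: r2p_lap_homog (toP_homog _).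
by rewrite IH ?(ltnW hi) // scaleNr addrC.
Qed.

Lemma opchain_Eop c : opchain Eop (epsl R n k) k.+1 c = fun=> 0.
Proof.
apply/funext => e; rewrite -mcoeff_toP toP_opchain // /r2lap (iter_lap_big _ (toP_homog c)); last by lia.
by rewrite mulr0 mcoeff0.
Qed.

Lemma toP_Lop m c : toP (Lop m c) = Lam k m (toP c).
Proof.
rewrite /Lam; under eq_bigr => i _ do rewrite -toP_opchain ?(ltnW (ltn_ord i)) //.
rewrite /toP; under [RHS]eq_bigr => i _ do rewrite scaler_sumr.
rewrite exchange_big; apply: eq_bigr => e _ /=; rewrite /Lop scaler_suml.
by apply: eq_bigr => i _; rewrite scalerA.
Qed.

(** The interface between algebra and analysis: only nodes, weights and evaluations occur in it. The
    second clause turns psd forms into sums of 2m-th powers; the last two identify the quadrature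
    with the spherical mean up to a factor. *)
Lemma quadrature_identities m : (k <= m)%N ->
  exists (I : finType) (W : I -> R) (t : I -> 'I_n -> R),
  [/\ forall v, 0 <= W v,
      forall c x, r2r x ^+ (m - k) * evr (Lop m c) x =
        ((m.*2)`!%:R)^-1 * \sum_v W v * evr c (t v) * (\sum_i t v i * x i) ^+ m.*2,
      forall c, \sum_v W v * evr (Eop c) (t v) =
        epsl R n k k * \sum_v W v * evr c (t v) &
      exists2 kap, 0 < kap &
        forall x, \sum_v W v * (\sum_i x i * t v i) ^+ k.*2 = kap * r2r x ^+ k].
Proof.
move=> hkm.
have [I [W [t [W0 G1 st]]]] := gauss_functional R n (k.*2 + m.*2).
pose G (p : {mpoly R[n]}) := \sum_v W v * p.@[t v].
have linG : scalar G.
  move=> a f g; rewrite /G /= mulr_sumr -big_split /=; apply: eq_bigr => v _.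
  by rewrite mevalD mevalZ mulrDr mulrCA.
have linpE x y : (linp x).@[y] = \sum_i x i * y i.
  rewrite /linp (raddf_sum (meval y)); apply: eq_bigr => i _ /=.
  by rewrite mevalZ mevalXU.
have f0 j : (j`!)%:R != 0 :> R by rewrite pnatr_eq0 -lt0n fact_gt0.
exists I, W, t; split => //.
- move=> c x.
  have := G_linp_even linG G1 st x (toP_homog c) hkm (leqnn _).
  rewrite -toP_Lop r2pE /evr -!meval_toP -/(r2r x) => /(congr1 (fun y => ((m.*2)`!%:R)^-1 * y)).
  rewrite mulKf // => <-; congr (_ * _); rewrite /G; apply: eq_bigr => v _.
  rewrite mevalM rmorphXn /= linpE mulrA meval_toP; congr (_ * _ ^+ _).
  by apply: eq_bigr => i _; rewrite mulrC.
- move=> c; have := G_r2plap linG st (toP_homog c) (leq_addr _ _).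
  rewrite /G => h; transitivity (\sum_v W v * (r2p R n * lap (toP c)).@[t v]).
    apply: eq_bigr => v _; rewrite /evr -meval_toP.
    (* Since eps_0 = 0, the chain of length one is E itself. *)
    have -> : toP (Eop c) = r2p R n * lap (toP c); last by [].
    have := @toP_opchain 1 c isT; rewrite /r2lap /= expr1 => <-; congr toP.
    by apply/funext => e; rewrite /epsl mulr0 !mul0r subr0.
  by rewrite h; congr (_ * _); apply: eq_bigr => v _; rewrite meval_toP.
(* The constant (2k)! / (2^k k!) is the moment of order 2k of the normal law; it comes from the
   moment formula for the constant form 1. *)
exists ((k.*2)`!%:R * acoef R 0 k 0).
  by rewrite mulr_gt0 ?acoef_gt0 // ltr0n fact_gt0.
move=> x.
have h1 : (1 : {mpoly R[n]}) \is (0.*2).-homog by apply: dhomog1.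
have hN : (0.*2 + k.*2 <= k.*2 + m.*2)%N by lia.
have := G_linp_even linG G1 st x h1 (leq0n k) hN.
rewrite mul1r meval_Lam big_ord_recl big_ord0 addr0 /r2lap expr0 mul1r /= meval1 mulr1 subn0 r2pE -/(r2r x).
rewrite [_ ^+ k * _]mulrC mulrA => <-; rewrite /G; apply: eq_bigr => v _.
by rewrite rmorphXn /= linpE.
Qed.

(* For [m = k] the quadrature formula is an identity between forms of degree
   [2k], so that it also gives the coefficients. *)
Lemma Lop_coef : exists (I : finType) (W : I -> R) (t : I -> 'I_n -> R) (q : I -> D),
  [/\ forall v, 0 <= W v,
      forall c e, Lop k c e = \sum_v W v * evr c (t v) * q v e,
      forall v x, evr (q v) x = ((k.*2)`!%:R)^-1 * (\sum_i t v i * x i) ^+ k.*2 &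
      exists2 kap, 0 < kap &
        forall x, \sum_v W v * (\sum_i x i * t v i) ^+ k.*2 = kap * r2r x ^+ k].
Proof.
have [I [W [t [W0 h1 _ h3]]]] := quadrature_identities (leqnn k).
pose q v : D := fromP (((k.*2)`!%:R)^-1 *: linp (t v) ^+ k.*2).
have hq v : ((k.*2)`!%:R)^-1 *: linp (t v) ^+ k.*2 \is (k.*2).-homog.
  by apply: dhomogZ; have := dhomogMn k.*2 (linp_homog (t v)); rewrite mul1n.
have eq v x : evr (q v) x = ((k.*2)`!%:R)^-1 * (\sum_i t v i * x i) ^+ k.*2.
  rewrite /evr -meval_toP fromPK // mevalZ rmorphXn /= /linp (raddf_sum (meval x)).
  congr (_ * _ ^+ _); apply: eq_bigr => i _ /=.
  by rewrite mevalZ mevalXU.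
exists I, W, t, q; split=> // c e.
pose p := toP (Lop k c) - \sum_v (W v * evr c (t v)) *: toP (q v).
have hp : p \is (k.*2).-homog.
  apply: rpredB; first exact: toP_homog.
  by apply: rpred_sum => v _; apply: dhomogZ; exact: toP_homog.
have p0 : p = 0.
  apply: (homog_eq0 hp) => x; rewrite /p mevalB meval_toP (raddf_sum (meval x)) /=.
  have := h1 c x; rewrite subnn expr0 mul1r /evr => ->.
  rewrite mulr_sumr -sumrB big1 // => v _; rewrite mevalZ meval_toP.
  by have := eq v x; rewrite /evr => ->; ring.
rewrite -mcoeff_toP; move/eqP: p0; rewrite subr_eq0 => /eqP ->.
by rewrite raddf_sum; apply: eq_bigr => v _ /=; rewrite mcoeffZ mcoeff_toP.
Qed.

Lemma r2_coef : exists c : D, forall x, evr c x = r2r x ^+ k.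
Proof.
exists (fromP (r2p R n ^+ k)) => x; rewrite /evr -meval_toP fromPK ?r2pX_homog //.
by rewrite rmorphXn /= r2pE.
Qed.

End Operator.
End FormOps.

From mathcomp Require Import all_classical all_reals all_analysis.
From mathcomp Require Import measurable_realfun.
Local Open Scope classical_set_scope.
Local Open Scope ring_scope.

(** * Linear changes of variables *)

Section LebesgueLine.
Context {R : realType}.
Notation mu := (@lebesgue_measure R).

(** Measurability is not assumed: a nonnegative integral is a supremum over simple functions below
    the integrand. Hence the section of [Kcone] can be compared with other sets by inclusion
    alone. *)
Lemma le_integral_nonneg (f g : R -> \bar R) :
  (forall t, (0 <= f t)%E) -> (forall t, (f t <= g t)%E) ->
  (\int[mu]_t f t <= \int[mu]_t g t)%E.
Proof.
move=> f0 fg; have g0 t : (0 <= g t)%E by apply: le_trans (fg t).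
rewrite !ge0_integralTE //; apply: le_ereal_sup => _ [h hf <-]; exists h => //= t.
exact: le_trans (hf t) (fg t).
Qed.

Definition affine (a b t : R) : measurableTypeR R := a * t + b.

Lemma measurable_affine a b : measurable_fun setT (affine a b : measurableTypeR R -> _).
Proof. by apply: measurable_funD => //; apply: measurable_funM. Qed.

(** The scaled pushforward agrees with Lebesgue measure on half-open intervals, and uniqueness does
    the rest. *)
Lemma lebesgue_measure_affine (a b : R) (a0 : 0 < a) (A : set (measurableTypeR R)) :
  measurable A -> (a%:E * pushforward mu (affine a b) A)%E = mu A.
Proof.
move=> mA.
pose nu0 : {measure set (measurableTypeR R) -> \bar R} :=
  mscale (NngNum (ltW a0)) (pushforward mu (affine a b)).
pose nu := nu0 (measurable_affine a b).
rewrite (_ : (a%:E * _)%E = nu A) //; symmetry.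
apply: lebesgue_measure_unique => // _ [[p q]] _ <- /=.
rewrite /nu /nu0 /mscale /= /pushforward.
have -> : affine a b @^-1` `]p, q]%classic = `](p - b) / a, (q - b) / a]%classic.
  apply/seteqP; split => t /=; rewrite !in_itv /= /affine.
    by rewrite ltr_pdivrMr // ler_pdivlMr // ltrBlDr lerBrDr mulrC.
  by rewrite ltr_pdivrMr // ler_pdivlMr // ltrBlDr lerBrDr mulrC.
rewrite !lebesgue_measure_itv /= !lte_fin ltr_pM2r ?invr_gt0 // ltrD2r.
case: ifP => _; last by rewrite mule0.
by rewrite -!EFinB -EFinM; congr EFin; field; rewrite gt_eqF.
Qed.

Lemma integral_affine_pos (f : R -> \bar R) (a b : R) : 0 < a ->
  measurable_fun setT f -> (forall t, (0 <= f t)%E) ->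
  (a%:E * \int[mu]_t f (a * t + b)%R = \int[mu]_t f t)%E.
Proof.
move=> a0 mf f0.
pose nu0 : {measure set (measurableTypeR R) -> \bar R} :=
  mscale (NngNum (ltW a0)) (pushforward mu (affine a b)).
pose nu := nu0 (measurable_affine a b).
transitivity (\int[nu]_t f t)%E.
  rewrite ge0_integral_mscale //= ge0_integral_pushforward //.
  exact: measurable_affine.
apply: eq_measure_integral => A mA _; exact: lebesgue_measure_affine.
Qed.

Lemma integral_opp (f : R -> \bar R) :
  measurable_fun setT f -> (forall t, (0 <= f t)%E) ->
  (\int[mu]_t f (- t)%R = \int[mu]_t f t)%E.
Proof.
move=> mf f0.
transitivity (\int[pushforward mu (-%R : _ -> measurableTypeR R)]_t f t)%E.
  by rewrite ge0_integral_pushforward.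
by apply: eq_measure_integral => //= A mA _; apply: lebesgue_measureN.
Qed.

Lemma integral_affine (f : R -> \bar R) (a b : R) : a != 0 ->
  measurable_fun setT f -> (forall t, (0 <= f t)%E) ->
  (`|a|%:E * \int[mu]_t f (a * t + b)%R = \int[mu]_t f t)%E.
Proof.
move=> a0 mf f0; have [ap|an|/eqP] := ltgtP 0 a; last by rewrite eq_sym (negbTE a0).
  by rewrite gtr0_norm // integral_affine_pos.
rewrite ltr0_norm //.
have mg : measurable_fun setT (fun t : R => f (- t)) by apply: measurableT_comp.
have := @integral_affine_pos (fun t => f (- t)) (- a) (- b).
rewrite oppr_gt0 => /(_ an mg (fun t => f0 _)); rewrite integral_opp // => <-.
by congr (_ * _)%E; apply: eq_integral => t _; congr f; ring.
Qed.
End LebesgueLine.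

(** * Iterated integrals and the order of integration *)

Section IteratedIntegral.
Context {R : realType} {I : finType}.
Notation mu := (@lebesgue_measure R).
Implicit Types (F G : (I -> R) -> \bar R) (x : I -> R) (s : seq I) (i j : I).

(* Measurability for the product sigma-algebra of [I -> R], expressed through
   all coordinatewise measurable maps into [I -> R]. *)
Definition pmeasurable {d'} {U : measurableType d'} (F : (I -> R) -> U) :=
  forall d (T : measurableType d) (phi : T -> I -> R),
    (forall i, measurable_fun setT (fun t => phi t i)) ->
    measurable_fun setT (F \o phi).

Lemma updE x i t j : upd x i t j = if j == i then t else x j.
Proof. by []. Qed.

Lemma upd_comm x i j a b : i != j ->
  upd (upd x i a) j b = upd (upd x j b) i a.
Proof.
move=> ij; apply/funext => l; rewrite /upd.
by case: eqP => // ->; rewrite eq_sym (negbTE ij).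
Qed.

Lemma iter_int_ge0 s F x : (forall y, (0 <= F y)%E) -> (0 <= iter_int s F x)%E.
Proof.
move=> F0; elim: s x => //= i s IH x; apply: integral_ge0 => t _; exact: IH.
Qed.

Lemma iter_int_le s F G x : (forall y, (0 <= F y)%E) -> (forall y, (F y <= G y)%E) ->
  (iter_int s F x <= iter_int s G x)%E.
Proof.
move=> F0 FG; elim: s x => //= i s IH x; apply: le_integral_nonneg => t //.
exact: iter_int_ge0.
Qed.

Lemma eq_iter_int s F G x : F =1 G -> iter_int s F x = iter_int s G x.
Proof. by move=> /funext ->. Qed.

Lemma iter_int_eq_on s F x y : (forall j, j \notin s -> x j = y j) ->
  iter_int s F x = iter_int s F y.
Proof.
elim: s x y => [|i s IH] x y h /=; first by congr F; apply/funext => j; apply: h.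
apply: eq_integral => t _; apply: IH => j hj; rewrite /upd; case: eqP => // /eqP ji.
by apply: h; rewrite inE negb_or ji.
Qed.

Lemma pmeasurable_upd_meas d (T : measurableType d) (phi : T -> I -> R) i :
  (forall j, measurable_fun setT (fun t => phi t j)) ->
  forall j, measurable_fun setT (fun z : T * R => upd (phi z.1) i z.2 j).
Proof.
move=> mphi j; rewrite /upd; case: (j == i); first exact: measurable_snd.
by apply: (measurableT_comp (mphi j)); exact: measurable_fst.
Qed.

(** The reason for quantifying over all parameter spaces in [pmeasurable]: the integration variable
    is adjoined to [T], and Tonelli returns measurability in the remaining parameter. *)
Lemma pmeasurable_integral F i : (forall x, (0 <= F x)%E) -> pmeasurable F ->
  pmeasurable (fun x => (\int[mu]_t F (upd x i t))%E).
Proof.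
move=> F0 gF d T phi mphi.
pose f := (fun z : T * (measurableTypeR R) => F (upd (phi z.1) i z.2)).
have mf : measurable_fun setT f := gF _ _ _ (pmeasurable_upd_meas i mphi).
exact: (@measurable_fun_fubini_tonelli_F _ _ _ _ _ mu f mf (fun z => F0 _)).
Qed.

Lemma pmeasurable_iter_int s F : (forall x, (0 <= F x)%E) -> pmeasurable F -> pmeasurable (iter_int s F).
Proof.
move=> F0 gF; elim: s => [//|i s IH] /=; apply: pmeasurable_integral => // x.
exact: iter_int_ge0.
Qed.

Lemma pmeasurable_line F x i : pmeasurable F -> measurable_fun setT (fun t : R => F (upd x i t)).
Proof.
move=> gF; apply: (gF _ (measurableTypeR R) (fun t => upd x i t)) => j.
rewrite /upd; case: (j == i) => //; exact: measurable_cst.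
Qed.

Lemma integral_swap F x i j : i != j -> (forall y, (0 <= F y)%E) -> pmeasurable F ->
  (\int[mu]_s \int[mu]_t F (upd (upd x i s) j t) =
   \int[mu]_s \int[mu]_t F (upd (upd x j s) i t))%E.
Proof.
move=> ij F0 gF.
pose f := (fun z : measurableTypeR R * measurableTypeR R => F (upd (upd x i z.1) j z.2)).
have mf : measurable_fun setT f.
  apply: (gF _ _ (fun z : measurableTypeR R * measurableTypeR R => upd (upd x i z.1) j z.2)) => l.
  rewrite /upd; case: (l == j); first exact: measurable_snd.
  by case: (l == i); [exact: measurable_fst | exact: measurable_cst].
rewrite (@fubini_tonelli _ _ _ _ _ mu mu f mf (fun z => F0 _)).
by apply: eq_integral => s _; apply: eq_integral => t _; rewrite /f /= upd_comm.
Qed.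

Lemma iter_int_front s1 s2 i F x : uniq (s1 ++ i :: s2) -> (forall y, (0 <= F y)%E) -> pmeasurable F ->
  iter_int (s1 ++ i :: s2) F x = iter_int (i :: s1 ++ s2) F x.
Proof.
move=> u F0 gF; elim: s1 x u => [//|j s1 IH] x /= /andP[hj u].
have ij : j != i.
  by apply: contra hj => /eqP ->; rewrite mem_cat inE eqxx orbT.
under eq_integral => t _ do rewrite IH //=.
apply: integral_swap => // [y|]; first exact: iter_int_ge0.
exact: pmeasurable_iter_int.
Qed.

Lemma iter_int_perm s s' F x : uniq s -> perm_eq s s' -> (forall y, (0 <= F y)%E) -> pmeasurable F ->
  iter_int s F x = iter_int s' F x.
Proof.
move=> us pss F0 gF; elim: s s' x us pss => [|i s IH] s' x us pss.
  by rewrite perm_sym in pss; rewrite (perm_nilP pss).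
have us' : uniq s' by rewrite -(perm_uniq pss).
have his : i \in s' by rewrite -(perm_mem pss) mem_head.
case/splitPr: his us' pss => s1 s2 us' pss.
rewrite iter_int_front //=; apply: eq_integral => t _; apply: IH.
  by case/andP: us.
by rewrite -(perm_cons i) (perm_trans pss) //; exact/permEl/(perm_catCA s1 [:: i] s2).
Qed.

Lemma leb_int_perm s F : perm_eq s (enum I) -> (forall y, (0 <= F y)%E) -> pmeasurable F ->
  leb_int F = iter_int s F (fun=> 0).
Proof.
move=> p F0 gF; rewrite /leb_int; apply: iter_int_perm => //.
  exact: enum_uniq.
by rewrite perm_sym.
Qed.
End IteratedIntegral.

(** * Substitution by an invertible matrix *)

Section LinearChange.
Context {R : realType}.
Notation mu := (@lebesgue_measure R).

Lemma pmeasurable_comp d (U : measurableType d) (I J : finType) (F : (J -> R) -> U) (psi : (I -> R) -> J -> R) :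
  (forall j, pmeasurable (fun x => psi x j : measurableTypeR R)) -> pmeasurable F -> pmeasurable (F \o psi).
Proof.
move=> hpsi gF d' T phi mphi.
by apply: (gF _ _ (fun t => psi (phi t))) => j; apply: (hpsi j).
Qed.

Lemma pmeasurable_coord (I : finType) (i : I) : pmeasurable (fun x : I -> R => x i : measurableTypeR R).
Proof. by move=> d T phi mphi; apply: mphi. Qed.

Lemma pmeasurable_cst d (U : measurableType d) (I : finType) (c : U) : pmeasurable (fun _ : I -> R => c).
Proof. by move=> d' T phi mphi; apply: measurable_cst. Qed.

Definition mact (I : finType) (L : I -> I -> R) (x : I -> R) : I -> R :=
  fun i => \sum_j L i j * x j.

Lemma pmeasurable_lin (I : finType) (a : I -> R) :
  pmeasurable (fun x : I -> R => (\sum_j a j * x j) : measurableTypeR R).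
Proof.
move=> d T phi mphi; apply: (@measurable_sum _ _ _ _ _ _ (fun j t => a j * phi t j)) => j.
by apply: measurable_funM => //; apply: measurable_cst.
Qed.

Lemma mact_upd (I : finType) (L : I -> I -> R) (x : I -> R) (i j : I) t :
  mact L (upd x i t) j = L j i * t + \sum_(l | l != i) L j l * x l.
Proof.
rewrite /mact (bigD1 i) //= /upd eqxx; congr (_ + _).
by apply: eq_bigr => l /negbTE ->.
Qed.

Lemma mact_upd0 (I : finType) (L : I -> I -> R) (x : I -> R) (i j : I) t :
  L j i = 0 -> mact L (upd x i t) j = mact L x j.
Proof. by move=> h; rewrite mact_upd /mact [RHS](bigD1 i) //= h !mul0r. Qed.

(** Within [s], each new coordinate depends on its own variable and on those integrated further
    outside, so at every level the substitution is a one-dimensional affine map with slope [L i i].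
    The point [y] carries the images of the coordinates already fixed. *)
Lemma iter_int_triangular (I : finType) (L : I -> I -> R) (s : seq I) F x y :
  (forall y, (0 <= F y)%E) -> pmeasurable F ->
  (forall i, L i i != 0) -> uniq s ->
  (forall s1 s2, s = s1 ++ s2 -> forall j l, j \notin s2 -> l \in s2 -> L j l = 0) ->
  (forall j, j \notin s -> y j = mact L x j) ->
  ((\prod_(i <- s) `|L i i|)%:E * iter_int s (F \o mact L) x = iter_int s F y)%E.
Proof.
move=> F0 gF L0; elim: s x y => [|i s IH] x y us htri hy /=.
  rewrite big_nil mul1e; congr F; apply/funext => j; rewrite hy //.
case/andP: us => his us.
have htri' s1 s2 : s = s1 ++ s2 -> forall j l, j \notin s2 -> l \in s2 -> L j l = 0.
  by move=> h; apply: (htri (i :: s1)); rewrite h.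
rewrite big_cons EFinM -muleA.
rewrite -ge0_integralZl_EFin //; last 3 first.
- by move=> t _; apply: iter_int_ge0 => z; apply: F0.
- apply: pmeasurable_line; apply: pmeasurable_iter_int => [z|]; first exact: F0.
  by apply: pmeasurable_comp => // j; apply: pmeasurable_lin.
- by apply: prodr_ge0.
pose b := \sum_(l | l != i) L i l * x l.
have E t : ((\prod_(j <- s) `|L j j|)%:E * iter_int s (F \o mact L) (upd x i t))%E =
   iter_int s F (upd y i (L i i * t + b)).
  apply: IH => // j hj; rewrite updE; case: eqP => [->|/eqP ji]; first by rewrite mact_upd.
  rewrite mact_upd0; first by apply: hy; rewrite inE negb_or ji.
  by apply: (htri [::] (i :: s)) => //; rewrite ?mem_head // inE negb_or ji.
under eq_integral => t _ do rewrite E.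
apply: (@integral_affine R (fun t => iter_int s F (upd y i t))) => //.
- by apply: pmeasurable_line; apply: pmeasurable_iter_int.
- by move=> t; apply: iter_int_ge0.
Qed.

Lemma iter_int_relabel (I J : finType) (g : J -> I) (h : I -> J) (s : seq I) F x :
  cancel g h -> cancel h g ->
  iter_int s (fun z : I -> R => F (fun j => z (g j))) x =
  iter_int (map h s) F (fun j => x (g j)).
Proof.
move=> gh hg; elim: s x => //= i s IH x; apply: eq_integral => t _; rewrite IH.
congr iter_int; apply/funext => j; rewrite /upd.
by rewrite -[in LHS](hg i) (can_eq gh).
Qed.

Lemma leb_int_relabel (I J : finType) (g : J -> I) (h : I -> J) F :
  cancel g h -> cancel h g -> (forall y, (0 <= F y)%E) -> pmeasurable F ->
  leb_int (fun z : I -> R => F (fun j => z (g j))) = leb_int F.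
Proof.
move=> gh hg F0 gF; rewrite /leb_int (iter_int_relabel _ _ _ gh hg) //.
have um : uniq (map h (enum I)) by rewrite (map_inj_uniq (can_inj hg)) enum_uniq.
apply: iter_int_perm => //; apply: uniq_perm => //; first exact: enum_uniq.
by move=> j; rewrite mem_enum -[j]gh map_f // mem_enum.
Qed.

Definition lin_change n (A : 'M[R]_n) := forall F, (forall y, (0 <= F y)%E) -> pmeasurable F ->
  (`|\det A|%:E * leb_int (F \o mact A))%E = leb_int F.

Lemma mact_mul n (A B : 'M[R]_n) x : mact (A *m B) x = mact A (mact B x).
Proof.
apply/funext => i; rewrite /mact; under eq_bigr do rewrite mxE mulr_suml.
rewrite exchange_big; apply: eq_bigr => j _; rewrite mulr_sumr.
by apply: eq_bigr => l _; rewrite mulrA.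
Qed.

Lemma mact1 n (x : 'I_n -> R) : mact 1%:M x = x.
Proof.
apply/funext => i; rewrite /mact (bigD1 i) //= !mxE eqxx mul1r big1 ?addr0 // => j /negbTE h.
by rewrite !mxE eq_sym h mul0r.
Qed.

Lemma lin_change_mul n (A B : 'M[R]_n) : lin_change A -> lin_change B -> lin_change (A *m B).
Proof.
move=> cA cB F F0 gF; rewrite -[RHS](cA F F0 gF) -[in RHS]cB => [|y|]; last first.
- by apply: pmeasurable_comp => // j; apply: pmeasurable_lin.
- exact: F0.
rewrite det_mulmx normrM EFinM muleA; congr (_ * leb_int _)%E.
by apply/funext => x; rewrite /= mact_mul.
Qed.

Lemma lin_change_perm n (s : 'S_n) : lin_change (perm_mx s).
Proof.
move=> F F0 gF; rewrite det_perm normrX normrN1 expr1n mul1e.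
rewrite -[RHS](@leb_int_relabel _ _ s s^-1%g) //; last 2 first.
- exact: permK.
- exact: permKV.
congr leb_int; apply/funext => x /=; congr F; apply/funext => i.
rewrite /mact (bigD1 (s i)) //= big1 ?addr0 => [|j hj]; first by rewrite !mxE eqxx mul1r.
by rewrite !mxE eq_sym (negbTE hj) mul0r.
Qed.

Lemma lin_change_lower n (A : 'M[R]_n) : (forall i j : 'I_n, (i < j)%N -> A i j = 0) ->
  (forall i, A i i != 0) -> lin_change A.
Proof.
move=> hA A0 F F0 gF.
rewrite det_trig; last by apply/is_trig_mxP.
rewrite normr_prod -big_enum /=.
apply: iter_int_triangular => //; first exact: enum_uniq; last first.
  by move=> j; rewrite mem_enum.
move=> s1 s2 hs j l hj hl; apply: hA; rewrite -(index_enum_ord j) -(index_enum_ord l) hs !index_cat.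
have hj1 : j \in s1 by have := mem_enum 'I_n j; rewrite hs mem_cat (negbTE hj) orbF.
have hl1 : l \notin s1.
  have := enum_uniq 'I_n; rewrite hs cat_uniq => /and3P[_ /hasPn h _]; exact: h.
by rewrite hj1 (negbTE hl1); apply: leq_trans (leq_addr _ _); rewrite index_mem.
Qed.

Lemma lin_change_upper n (A : 'M[R]_n) : (forall i j : 'I_n, (j < i)%N -> A i j = 0) ->
  (forall i, A i i != 0) -> lin_change A.
Proof.
move=> hA A0 F F0 gF.
rewrite -det_tr det_trig; last by apply/is_trig_mxP => i j ij; rewrite mxE hA.
under eq_bigr do rewrite mxE.
(* An upper triangular matrix has the required triangular shape once the variables are integrated in
   reverse order. *)
have p : perm_eq (rev (enum 'I_n)) (enum 'I_n) by rewrite perm_rev.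
rewrite !(leb_int_perm p) //; last 2 first.
- by move=> y; apply: F0.
- by apply: pmeasurable_comp => // j; apply: pmeasurable_lin.
rewrite normr_prod -big_enum /= -(perm_big _ p).
apply: iter_int_triangular => //; first by rewrite rev_uniq enum_uniq.
  move=> s1 s2 hs j l hj hl.
  have hs' : enum 'I_n = rev s2 ++ rev s1 by rewrite -rev_cat -hs revK.
  apply: hA; rewrite -(index_enum_ord j) -(index_enum_ord l) hs' !index_cat.
  rewrite !mem_rev hl (negbTE hj); apply: leq_trans (leq_addr _ _).
  by rewrite index_mem mem_rev.
by move=> j; rewrite mem_rev mem_enum.
Qed.

(** The LUP decomposition leaves a permutation, a unit lower triangular and an upper triangular
    factor; the property passes to products. *)
Lemma lin_change_unit n (A : 'M[R]_n) : \det A != 0 -> lin_change A.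
Proof.
case: n A => [|n] A dA.
  apply: lin_change_lower => [[]|[]] //.
have := cormen_lup_correct A; have := cormen_lup_perm A; have := cormen_lup_detL A.
have := @cormen_lup_lower _ _ A; have := @cormen_lup_upper _ _ A.
case: (cormen_lup A) => [[P L] U] /= hU hL dL /is_perm_mxP [s ->] e.
have eA : A = perm_mx (s^-1)%g *m (L *m U).
  rewrite -[L *m U]/(L * U) -e -[perm_mx s * A]/(perm_mx s *m A) mulmxA -perm_mxM.
  by rewrite mulVg perm_mx1 mul1mx.
have dU : \det U != 0.
  by apply: contra dA => /eqP h; rewrite eA !det_mulmx h !mulr0.
rewrite eA; apply: lin_change_mul; first exact: lin_change_perm.
apply: lin_change_mul; [apply: lin_change_lower | apply: lin_change_upper => //].
- by move=> i j ij; rewrite hL ?(ltnW ij) // -val_eqE /= ltn_eqF.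
- by move=> i; rewrite hL // eqxx oner_neq0.
move=> i; move: dU; rewrite -det_tr det_trig; last by apply/is_trig_mxP => a b ab; rewrite mxE hU.
by move/prodf_neq0 => /(_ i isT); rewrite mxE.
Qed.

End LinearChange.

(** * Spherical means *)

Section Boxes.
Context {R : realType} {I : finType}.
Notation mu := (@lebesgue_measure R).
Implicit Types (F G : (I -> R) -> \bar R) (x c : I -> R) (s : seq I).

Definition box c (r : R) : set (I -> R) := [set x | forall i, `|x i - c i| <= r].

(** Membership in the box with the coordinates of [s] disregarded, namely those already integrated
    out. *)
Definition boxb s c (r : R) x : bool := [forall i, (i \in s) || (`|x i - c i| <= r)].

Lemma boxbP c r x : box c r x <-> boxb [::] c r x.
Proof.
split=> [h|/forallP h i]; last by have := h i; rewrite in_nil.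
by apply/forallP => i; rewrite in_nil /= h.
Qed.

Lemma indic_box c r x : \1_(box c r) x = (boxb [::] c r x)%:R :> R.
Proof.
rewrite indicE; congr (_%:R); congr nat_of_bool.
by apply/idP/idP => [/set_mem/boxbP|/boxbP/mem_set].
Qed.

Lemma boxb_upd s c r x i t : i \notin s ->
  boxb s c r (upd x i t) = (`|t - c i| <= r) && boxb (i :: s) c r x.
Proof.
move=> his; apply/forallP/andP => [h|[h1 /forallP h2] j].
  split; first by have := h i; rewrite /upd eqxx (negbTE his).
  apply/forallP => j; have := h j; rewrite /upd inE.
  by case: eqP => //= _ ->.
have := h2 j; rewrite /upd inE; case: eqP => //= -> _.
by rewrite h1 orbT.
Qed.

Lemma iter_int_box s (a : R) c r x : 0 <= a -> 0 <= r -> uniq s ->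
  iter_int s (fun z => (a * \1_(box c r) z)%:E) x =
  (a * (2 * r) ^+ size s * (boxb s c r x)%:R)%:E.
Proof.
move=> a0 r0; elim: s x => [|i s IH] x /=; first by rewrite indic_box expr0 mulr1.
move=> /andP[his us]; under eq_integral => t _ do rewrite IH // boxb_upd //.
set b := boxb (i :: s) c r x.
transitivity (\int[mu]_t ((a * (2 * r) ^+ size s * b%:R)%:E * (\1_(`[c i - r, c i + r]%classic : set R) t)%:E))%E.
  apply: eq_integral => t _; rewrite -EFinM; congr EFin.
  rewrite indicE mem_setE in_itv /= -ler_distlC distrC.
  by case: (`|c i - t| <= r) => /=; rewrite ?mulr1 ?mulr0.
rewrite ge0_integralZl_EFin //; last 2 first.
- by apply/measurable_EFinP; apply: measurable_indic.
- by rewrite !mulr_ge0 // exprn_ge0 // mulr_ge0.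
rewrite integral_indic // setIT /= lebesgue_measure_itv /= lte_fin.
case: ltP => [_|h].
  by rewrite -EFinD -EFinM exprSr; congr EFin; ring.
(* A degenerate box: the interval is a point and both sides are zero. *)
have -> : r = 0 by lra.
by rewrite mule0 mulr0 exprS !mul0r mulr0 mul0r.
Qed.

Lemma pmeasurable_le (f g : (I -> R) -> R) :
  pmeasurable (f : _ -> measurableTypeR R) -> pmeasurable (g : _ -> measurableTypeR R) ->
  pmeasurable (fun x => f x <= g x).
Proof. by move=> gf gg d T phi mphi; apply: measurable_fun_ler; [exact: gf|exact: gg]. Qed.

Lemma pmeasurable_bool (b : (I -> R) -> bool) : pmeasurable b ->
  pmeasurable (fun x => (b x)%:R : measurableTypeR R).
Proof.
move=> gb d T phi mphi.
have := gb d T phi mphi => h.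
rewrite (_ : _ \o _ = fun t => if b (phi t) then 1 else 0); last first.
  by apply/funext => t /=; case: (b _).
by apply: measurable_fun_ifT => //; exact: measurable_cst.
Qed.

Lemma pmeasurable_forall (J : finType) (b : J -> (I -> R) -> bool) : (forall j, pmeasurable (b j)) ->
  pmeasurable (fun x => [forall j, b j x]).
Proof.
move=> gb d T phi mphi.
rewrite (_ : _ \o _ = fun t => \big[andb/true]_(j <- enum J) b j (phi t)); last first.
  by apply/funext => t /=; rewrite big_enum big_andE.
elim: (enum J) => [|j l IH].
  under eq_fun do rewrite big_nil; exact: measurable_cst.
under eq_fun do rewrite big_cons; apply: measurable_and => //; exact: gb.
Qed.

Lemma pmeasurable_boxb s c r : pmeasurable (boxb s c r).
Proof.
apply: pmeasurable_forall => i; case: (i \in s); first exact: pmeasurable_cst.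
apply: pmeasurable_le; last exact: pmeasurable_cst.
move=> d T phi mphi; apply: measurableT_comp => //.
by apply: measurable_funB => //; exact: measurable_cst.
Qed.

Lemma pmeasurable_box (a : R) c r : pmeasurable (fun z => (a * \1_(box c r) z)%:E).
Proof.
move=> d T phi mphi; apply/measurable_EFinP; apply: measurable_funM.
  exact: measurable_cst.
under eq_fun do rewrite indic_box.
exact: (pmeasurable_bool (pmeasurable_boxb [::] c r)).
Qed.

Lemma leb_int_ge_box (f : (I -> R) -> R) (a : R) c r : 0 <= a -> 0 <= r ->
  (forall x, a * \1_(box c r) x <= f x) ->
  ((a * (2 * r) ^+ #|I|)%:E <= leb_int (fun x => (f x)%:E))%E.
Proof.
move=> a0 r0 h.
have -> : (a * (2 * r) ^+ #|I|)%:E = iter_int (enum I) (fun z => (a * \1_(box c r) z)%:E) (fun=> 0).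
  rewrite iter_int_box ?enum_uniq // -cardE; congr EFin.
  rewrite (_ : boxb _ _ _ _ = true) ?mulr1 //; apply/forallP => i.
  by rewrite mem_enum.
apply: iter_int_le => y; rewrite lee_fin //.
by rewrite mulr_ge0 // indicE; case: (_ \in _).
Qed.

Lemma leb_int_le_box (f : (I -> R) -> R) c r : 0 <= r -> (forall x, 0 <= f x) ->
  (forall x, f x <= \1_(box c r) x) ->
  (leb_int (fun x => (f x)%:E) <= ((2 * r) ^+ #|I|)%:E)%E.
Proof.
move=> r0 f0 h.
apply: (@le_trans _ _ (iter_int (enum I) (fun z => (1 * \1_(box c r) z)%:E) (fun=> 0))).
  by apply: iter_int_le => y; rewrite lee_fin // mul1r.
rewrite iter_int_box ?enum_uniq // mul1r -cardE lee_fin ler_piMr //.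
  by rewrite exprn_ge0 // mulr_ge0.
by case: boxb.
Qed.

(** A class of signed integrands, bounded and supported in the unit cube, for which every stage of
    the iterated integral is absolutely convergent and hence linear. *)
Definition bounded1 (f : (I -> R) -> R) :=
  pmeasurable (f : _ -> measurableTypeR R) /\
  exists2 M, 0 <= M & forall x, `|f x| <= M * \1_(box (fun=> 0) 1) x.

Lemma pmeasurable_EFin (f : (I -> R) -> R) : pmeasurable (f : _ -> measurableTypeR R) ->
  pmeasurable (fun x => (f x)%:E).
Proof. by move=> gf d T phi mphi; apply/measurable_EFinP; exact: gf. Qed.

Lemma pmeasurable_integral_signed F i : pmeasurable F -> pmeasurable (fun x : I -> R => (\int[mu]_t F (upd x i t))%E).
Proof.
move=> gF.
have E : (fun x : I -> R => (\int[mu]_t F (upd x i t))%E) =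
   (fun x => (\int[mu]_t (F^\+)%E (upd x i t) - \int[mu]_t (F^\-)%E (upd x i t))%E).
  apply/funext => x; rewrite [LHS]integralE; congr (_ - _)%E; apply: eq_integral => t _.
    by rewrite !funeposE.
  by rewrite !funenegE.
have gp : pmeasurable (F^\+)%E.
  by move=> d T phi mphi; rewrite -funepos_comp; apply: measurable_funepos; apply: gF.
have gn : pmeasurable (F^\-)%E.
  by move=> d T phi mphi; rewrite -funeneg_comp; apply: measurable_funeneg; apply: gF.
rewrite E => d T phi mphi; apply: emeasurable_funB.
- exact: (pmeasurable_integral i (funepos_ge0 F) gp mphi).
- exact: (pmeasurable_integral i (funeneg_ge0 F) gn mphi).
Qed.

Lemma pmeasurable_iter_int_signed s F : pmeasurable F -> pmeasurable (@iter_int R I s F).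
Proof. by move=> gF; elim: s => //= i s IH; apply: pmeasurable_integral_signed. Qed.

Lemma iter_int_abs_le s F G x : pmeasurable F -> pmeasurable G -> (forall y, `|F y| <= G y)%E ->
  (`|iter_int s F x| <= iter_int s G x)%E.
Proof.
move=> gF gG FG; elim: s x => //= i s IH x.
have mF := pmeasurable_line x i (pmeasurable_iter_int_signed s gF).
apply: (le_trans (le_abse_integral _ _ _)) => //.
by apply: le_integral_nonneg.
Qed.

Lemma bounded1_integrable f i s x : bounded1 f -> uniq (i :: s) ->
  mu.-integrable setT (fun t => iter_int s (fun z => (f z)%:E) (upd x i t)).
Proof.
move=> [gf [M M0 hM]] u; apply/integrableP; split.
  by apply: pmeasurable_line; apply: pmeasurable_iter_int_signed; apply: pmeasurable_EFin.
apply: (@le_lt_trans _ _ (iter_int (i :: s) (fun z => (M * \1_(box (fun=> 0) 1) z)%:E) x)).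
  apply: le_integral_nonneg => t //.
  by apply: iter_int_abs_le => [||y]; [exact: pmeasurable_EFin|exact: pmeasurable_box|rewrite lee_fin].
by rewrite iter_int_box // ltry.
Qed.

Lemma iter_int_linear s (a : R) f g x : bounded1 f -> bounded1 g -> uniq s ->
  iter_int s (fun z => (a * f z + g z)%:E) x =
  (a%:E * iter_int s (fun z => (f z)%:E) x + iter_int s (fun z => (g z)%:E) x)%E.
Proof.
move=> bf bg; elim: s x => [|i s IH] x u /=; first by rewrite EFinD EFinM.
have us : uniq s by case/andP: u.
under eq_integral => t _ do rewrite IH //.
have If := bounded1_integrable x bf u; have Ig := bounded1_integrable x bg u.
by rewrite integralD //= ?integralZl //; apply: integrableZl.
Qed.

Lemma leb_int_fin f : bounded1 f -> leb_int (fun z => (f z)%:E) \is a fin_num.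
Proof.
move=> [gf [M M0 hM]]; rewrite fin_num_abs /leb_int.
apply: (@le_lt_trans _ _ (iter_int (enum I) (fun z => (M * \1_(box (fun=> 0) 1) z)%:E) (fun=> 0))).
  by apply: iter_int_abs_le => [||y]; [exact: pmeasurable_EFin|exact: pmeasurable_box|rewrite lee_fin].
by rewrite iter_int_box ?enum_uniq // ltry.
Qed.

Lemma bounded1_lin (a : R) f g : bounded1 f -> bounded1 g -> bounded1 (fun x => a * f x + g x).
Proof.
move=> [gf [M M0 hM]] [gg [M' M0' hM']]; split.
  move=> d T phi mphi; apply: measurable_funD; last exact: gg.
  by apply: measurable_funM; [exact: measurable_cst | exact: gf].
exists (`|a| * M + M'); first by rewrite addr_ge0 // mulr_ge0.
move=> x; rewrite (le_trans (ler_normD _ _)) // normrM mulrDl -mulrA lerD // ler_wpM2l //.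
Qed.

Lemma leb_int_sum (J : Type) (l : seq J) (a : J -> R) (f : J -> (I -> R) -> R) :
  (forall j, bounded1 (f j)) ->
  leb_int (fun z => (\sum_(j <- l) a j * f j z)%:E) =
  (\sum_(j <- l) a j * fine (leb_int (fun z => (f j z)%:E)))%:E.
Proof.
move=> bf.
have b0 : bounded1 (fun=> 0).
  split; first exact: pmeasurable_cst.
  by exists 0 => // x; rewrite normr0 mul0r.
have : bounded1 (fun z => \sum_(j <- l) a j * f j z) /\
  leb_int (fun z => (\sum_(j <- l) a j * f j z)%:E) =
  (\sum_(j <- l) a j * fine (leb_int (fun z => (f j z)%:E)))%:E; last by case.
elim: l => [|j l [IH1 IH2]].
  rewrite big_nil (_ : (fun z => _) = fun=> 0); last by apply/funext => z; rewrite big_nil.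
  split => //; have := @iter_int_box (enum I) 0 (fun=> 0) 0 (fun=> 0) (lexx _) (lexx _) (enum_uniq _).
  rewrite !mul0r => <-; rewrite /leb_int; congr iter_int.
  by apply/funext => z; rewrite big_nil mul0r.
have E : (fun z => \sum_(k <- j :: l) a k * f k z) = (fun z => a j * f j z + \sum_(k <- l) a k * f k z).
  by apply/funext => z; rewrite big_cons.
split; first by rewrite E; apply: bounded1_lin.
rewrite big_cons EFinD -IH2 EFinM fineK; last exact: leb_int_fin.
under [X in leb_int X]eq_fun do rewrite big_cons.
by rewrite /leb_int iter_int_linear ?enum_uniq.
Qed.
End Boxes.

(** * The cone measure and its means *)

Section Sphere.
Context {R : realType} (n : nat).
Implicit Types (x v : 'I_n -> R) (g : ('I_n -> R) -> R).

Lemma r2_ge0 x : 0 <= r2 x.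
Proof. by apply: sumr_ge0 => i _; apply: sqr_ge0. Qed.

Lemma enorm_ge0 x : 0 <= enorm x.
Proof. exact: sqrtr_ge0. Qed.

Lemma sqr_enorm x : enorm x ^+ 2 = r2 x.
Proof. by rewrite sqr_sqrtr // r2_ge0. Qed.

Lemma coord_le_enorm x i : `|x i| <= enorm x.
Proof.
rewrite -sqrtr_sqr ler_wsqrtr // /r2 (bigD1 i) //= lerDl.
by apply: sumr_ge0 => j _; apply: sqr_ge0.
Qed.

Lemma coord_div_le1 x i : `|x i / enorm x| <= 1.
Proof.
rewrite normrM normfV (ger0_norm (enorm_ge0 x)).
have [e0|e0] := eqVneq (enorm x) 0; first by rewrite e0 invr0 mulr0.
by rewrite ler_pdivrMr ?mul1r ?coord_le_enorm // lt_neqAle eq_sym e0 enorm_ge0.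
Qed.

Definition ball_ext g x : R := \1_(@unit_ball R n) x * g (fun i => x i / enorm x).

(** Boundedness is asked on the cube because x / |x| always lies there, also at x = 0 where division
    yields 0. *)
Definition sph_ok g := pmeasurable (g : _ -> measurableTypeR R) /\
  exists2 M, 0 <= M & forall x, (forall i, `|x i| <= 1) -> `|g x| <= M.

Lemma pmeasurable_r2 : pmeasurable (@r2 R n : _ -> measurableTypeR R).
Proof.
move=> d T phi mphi; apply: (@measurable_sum _ _ _ _ _ _ (fun j t => phi t j ^+ 2)) => j.
exact: measurable_funX.
Qed.

Lemma pmeasurable_enorm : pmeasurable (@enorm R n : _ -> measurableTypeR R).
Proof.
move=> d T phi mphi.
rewrite (_ : _ \o _ = (fun y => y `^ 2^-1) \o (fun t => r2 (phi t))).
  by apply: measurableT_comp; [exact: measurable_powR | exact: pmeasurable_r2 mphi].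
by apply/funext => t /=; rewrite powR12_sqrt ?r2_ge0.
Qed.

Lemma pmeasurable_normalize i : pmeasurable (fun x : 'I_n -> R => x i / enorm x : measurableTypeR R).
Proof.
move=> d T phi mphi; apply: measurable_funM; first exact: mphi.
rewrite (_ : (fun _ => _) = (fun y => y `^ (- 1)) \o (fun t => enorm (phi t))).
  by apply: measurableT_comp; [exact: measurable_powR | exact: pmeasurable_enorm mphi].
by apply/funext => t /=; rewrite powR_inv1 ?enorm_ge0.
Qed.

Lemma indic_ballE x : \1_(@unit_ball R n) x = (enorm x <= 1)%R%:R :> R.
Proof.
rewrite indicE; congr (_%:R); congr nat_of_bool.
by apply/idP/idP => [/set_mem|/mem_set].
Qed.

Lemma pmeasurable_ball : pmeasurable (fun x => \1_(@unit_ball R n) x : measurableTypeR R).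
Proof.
move=> d T phi mphi; rewrite (_ : _ \o _ = fun t => (enorm (phi t) <= 1)%R%:R); last first.
  by apply/funext => t /=; rewrite indic_ballE.
have gle : pmeasurable (fun x : 'I_n -> R => enorm x <= 1).
  by apply: pmeasurable_le; [exact: pmeasurable_enorm | exact: pmeasurable_cst].
exact: (pmeasurable_bool gle mphi).
Qed.

Lemma indic_ball_le x : \1_(@unit_ball R n) x <= \1_(box (fun=> 0) 1) x :> R.
Proof.
rewrite indic_ballE; case: (leP (enorm x) 1) => [h|_]; last by rewrite indicE; case: (_ \in _).
rewrite indicE mem_set // => i; rewrite subr0; exact: le_trans (coord_le_enorm x i) h.
Qed.

Lemma sph_bounded1 g : sph_ok g -> bounded1 (ball_ext g).
Proof.
move=> [gg [M M0 hM]]; split.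
  move=> d T phi mphi; apply: measurable_funM; first exact: pmeasurable_ball mphi.
  have gn : pmeasurable (g \o (fun x i => x i / enorm x)).
    by apply: pmeasurable_comp => // j; apply: pmeasurable_normalize.
  exact: gn mphi.
exists M => // x; rewrite /ball_ext normrM mulrC.
have h1 : 0 <= \1_(@unit_ball R n) x :> R by rewrite indic_ballE.
rewrite (ger0_norm h1); apply: ler_pM => //; last exact: indic_ball_le.
by apply: hM => i; apply: coord_div_le1.
Qed.

Definition volB : R := fine (leb_vol (@unit_ball R n)).
Definition sph_mean g : R := fine (leb_int (fun x => (ball_ext g x)%:E)) * volB^-1.

Lemma sphere_int_sum (J : finType) (a : J -> R) (g : J -> ('I_n -> R) -> R) :
  (forall j, sph_ok (g j)) ->
  sphere_int (fun x => \sum_j a j * g j x) = (\sum_j a j * sph_mean (g j))%:E.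
Proof.
move=> hg; rewrite /sphere_int.
transitivity (leb_int (fun x => (\sum_j a j * ball_ext (g j) x)%:E) * (volB^-1)%:E)%E.
  congr (leb_int _ * _)%E; apply/funext => x; rewrite mulr_sumr; congr EFin.
  by apply: eq_bigr => j _; rewrite /ball_ext mulrCA.
rewrite leb_int_sum; last by move=> j; apply: sph_bounded1.
by rewrite -EFinM mulr_suml; congr EFin; apply: eq_bigr => j _; rewrite mulrA.
Qed.

Hypothesis n0 : (0 < n)%N.

Lemma enorm_le1 x : (forall i, `|x i| <= n%:R^-1) -> enorm x <= 1.
Proof.
move=> h; rewrite -sqrtr1 ler_wsqrtr // /r2.
have n1 : (1 : R) <= n%:R by rewrite ler1n.
apply: (@le_trans _ _ (\sum_(i < n) n%:R^-1)); last first.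
  by rewrite sumr_const card_ord -[_ *+ n]mulr_natl divff // gt_eqF // ltr0n.
apply: ler_sum => i _; rewrite -real_normK ?num_real // expr2.
have hn : (n%:R^-1 : R) <= 1 by rewrite invf_le1 // ltr0n.
by rewrite -[leRHS]mulr1; apply: ler_pM => //; apply: le_trans (h i) hn.
Qed.

Lemma bounded1_ball : bounded1 (fun x => \1_(@unit_ball R n) x).
Proof.
split; first exact: pmeasurable_ball.
exists 1 => // x; rewrite mul1r ger0_norm ?indic_ball_le // indic_ballE //.
Qed.

Lemma volB_gt0 : 0 < volB.
Proof.
have h := leb_int_fin bounded1_ball.
rewrite -lte_fin /volB /leb_vol fineK //.
apply: (@lt_le_trans _ _ (1 * (2 * n%:R^-1) ^+ #|'I_n|)%:E).
  by rewrite lte_fin mul1r exprn_gt0 // mulr_gt0 // invr_gt0 ltr0n.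
apply: (@leb_int_ge_box _ _ _ _ (fun=> 0)) => // x.
rewrite mul1r indic_ballE indicE; case: (boolP (_ \in _)) => [/set_mem hx|//].
by rewrite enorm_le1 // => i; have := hx i; rewrite subr0.
Qed.

Lemma sph_mean_coord_gt0 (i0 : 'I_n) d : sph_ok (fun x => x i0 ^+ d.*2) ->
  0 < sph_mean (fun x => x i0 ^+ d.*2).
Proof.
move=> hg; have h := leb_int_fin (sph_bounded1 hg).
rewrite /sph_mean divr_gt0 ?volB_gt0 // -lte_fin fineK //.
have nR : (0 : R) < n%:R by rewrite ltr0n.
(* On the box of radius r around (3r, ..., 3r) all coordinates lie between 2r and 4r = 1/n. The box
   is therefore inside the ball, and there x_i0 / |x| >= x_i0 >= 2r. *)
pose r : R := (4 * n%:R)^-1.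
have r0 : 0 < r by rewrite invr_gt0; lra.
have er : n%:R^-1 = 4 * r by rewrite /r; field; rewrite gt_eqF.
apply: (@lt_le_trans _ _ ((2 * r) ^+ d.*2 * (2 * r) ^+ #|'I_n|)%:E).
  by rewrite lte_fin mulr_gt0 // exprn_gt0 // mulr_gt0.
apply: (@leb_int_ge_box _ _ _ _ (fun=> 3 * r)); [by apply: exprn_ge0; lra | exact: ltW | ].
move=> x; rewrite indicE; case: (boolP (_ \in _)) => [/set_mem hx|_]; last first.
  rewrite mulr0 mulr_ge0 ?indic_ballE //.
  by rewrite -mul2n exprM exprn_ge0 // sqr_ge0.
have hx' i : 2 * r <= x i <= 4 * r.
  by have := hx i; rewrite ler_norml => /andP[a b]; apply/andP; split; lra.
have e1 : enorm x <= 1.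
  apply: enorm_le1 => i; have /andP[a b] := hx' i.
  by rewrite er ger0_norm //; lra.
rewrite /ball_ext indic_ballE e1 mulr1 mul1r.
have /andP[a b] := hx' i0.
have e0 : 0 < enorm x.
  have := coord_le_enorm x i0; apply: lt_le_trans; rewrite normr_gt0 gt_eqF //; lra.
apply: lerXn2r; rewrite ?nnegrE; first by lra.
  by apply: divr_ge0; lra.
by rewrite ler_pdivlMr //; apply: le_trans a; rewrite ler_piMr //; lra.
Qed.

End Sphere.

(** * Rotation invariance and means of powers of linear forms *)

Section Rotation.
Context {R : realType} (n : nat).
Implicit Types (x v : 'I_n -> R) (g : ('I_n -> R) -> R).

(** The reflection along w = v - |v| e_i0, which exchanges v and |v| e_i0; when w = 0 the identity
    serves. *)
Lemma householder v (i0 : 'I_n) : exists H : 'M[R]_n,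
  [/\ `|\det H| = 1, forall x, r2 (mact H x) = r2 x &
      forall x, \sum_i v i * mact H x i = enorm v * x i0].
Proof.
pose w (i : 'I_n) := v i - enorm v * (i == i0)%:R.
have sumE (a : 'I_n -> R) : \sum_i a i * (i == i0)%:R = a i0.
  rewrite (bigD1 i0) //= eqxx mulr1 big1 ?addr0 // => i /negbTE ->.
  by rewrite mulr0.
pose ww := \sum_i w i * w i.
have [ww0|wwn0] := eqVneq ww 0.
  have w0 i : w i = 0.
    apply/eqP; rewrite -sqrf_eq0 -[_ ^+ 2]/(w i * w i); apply/eqP.
    move/eqP: ww0; rewrite /ww psumr_eq0 => [/allP/(_ i)|j _]; last by rewrite -expr2 sqr_ge0.
    by rewrite mem_index_enum => /(_ isT)/eqP.
  exists 1%:M; split; first by rewrite det1 normr1.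
  - by move=> x; rewrite mact1.
  - move=> x; rewrite mact1.
    have E i : v i * x i = (enorm v * x i) * (i == i0)%:R.
      by have /eqP := w0 i; rewrite subr_eq0 => /eqP ->; ring.
    by under eq_bigr do rewrite E; rewrite sumE.
pose W : 'cV[R]_n := \col_i w i.
pose H : 'M[R]_n := 1%:M - (2 / ww) *: (W *m W^T).
have HE x i : mact H x i = x i - 2 / ww * w i * \sum_j w j * x j.
  have E j : H i j * x j = (j == i)%:R * x j - 2 / ww * w i * (w j * x j).
    by rewrite !mxE big_ord1 !mxE eq_sym; ring.
  rewrite /mact; under eq_bigr => j _ do rewrite E.
  rewrite sumrB -mulr_sumr; congr (_ - _); rewrite (bigD1 i) //= eqxx mul1r big1 ?addr0 // => j /negbTE ->.
  by rewrite mul0r.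
(* This holds because v and |v| e_i0 have the same norm. *)
have vw : \sum_i v i * w i = ww / 2.
  have e1 : \sum_i v i * w i = r2 v - enorm v * v i0.
    rewrite /r2 -(sumE v) mulr_sumr -sumrB; apply: eq_bigr => i _.
    by rewrite /w expr2; ring.
  have e2 : ww = \sum_i v i * w i - enorm v * w i0.
    rewrite /ww -(sumE w) mulr_sumr -sumrB; apply: eq_bigr => i _.
    by rewrite {1}/w; ring.
  have e3 : ww = 2 * (r2 v - enorm v * v i0).
    by rewrite e2 e1 /w eqxx mulr1 -(sqr_enorm v); ring.
  by rewrite e1 e3; field.
exists H; split.
- have HH : H *m H = 1%:M.
    have WW : W^T *m W = ww%:M.
      by rewrite [LHS]mx11_scalar !mxE; congr (_%:M); apply: eq_bigr => i _; rewrite !mxE.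
    rewrite /H mulmxBl mul1mx mulmxBr mulmx1 -scalemxAl -scalemxAr !scalerA.
    rewrite -[W *m W^T *m (W *m W^T)]mulmxA [W^T *m (_ *m _)]mulmxA WW mul_scalar_mx -scalemxAr scalerA.
    have -> : 2 / ww * (2 / ww) * ww = 2 * (2 / ww) by field.
    apply/matrixP => i j; rewrite !mxE; ring.
  have /eqP : \det H ^+ 2 = 1 by rewrite expr2 -det_mulmx HH det1.
  by rewrite sqrf_eq1 => /orP[] /eqP ->; rewrite ?normrN1 ?normr1.
- move=> x; rewrite /r2; set s := \sum_j w j * x j.
  have E i : mact H x i ^+ 2 = x i ^+ 2 - (4 / ww * s) * (w i * x i) + (2 / ww * s) ^+ 2 * (w i * w i).
    by rewrite HE -/s; ring.
  under eq_bigr => i _ do rewrite E.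
  rewrite big_split sumrB /= -!mulr_sumr -/s -/ww.
  by field.
- move=> x; set s := \sum_j w j * x j.
  have E i : v i * mact H x i = v i * x i - (2 / ww * s) * (v i * w i).
    by rewrite HE -/s; ring.
  under eq_bigr => i _ do rewrite E.
  rewrite sumrB -mulr_sumr vw.
  have -> : 2 / ww * s * (ww / 2) = s by field.
  rewrite -sumrB -(sumE x) mulr_sumr; apply: eq_bigr => i _.
  by rewrite /w; ring.
Qed.

Lemma sph_ok_power v k : sph_ok (fun x : 'I_n -> R => (\sum_i v i * x i) ^+ k).
Proof.
split.
  move=> d T phi mphi; apply: measurable_funX; exact: pmeasurable_lin mphi.
exists ((\sum_i `|v i|) ^+ k); first by apply: exprn_ge0; apply: sumr_ge0.
move=> x hx; rewrite normrX; apply: lerXn2r; rewrite ?nnegrE //; first exact: sumr_ge0.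
apply: le_trans (ler_norm_sum _ _ _) _; apply: ler_sum => i _.
by rewrite normrM ler_piMr.
Qed.

Lemma sph_mean_power v (i0 : 'I_n) k :
  sph_mean (fun x => (\sum_i v i * x i) ^+ k.*2) = r2 v ^+ k * sph_mean (fun x => x i0 ^+ k.*2).
Proof.
have [H [dH rH vH]] := householder v i0.
have eH x : enorm (mact H x) = enorm x by rewrite /enorm rH.
have dH0 : \det H != 0 by rewrite -normr_eq0 dH oner_neq0.
have ok0 : sph_ok (fun x : 'I_n -> R => x i0 ^+ k.*2).
  have -> : (fun x : 'I_n -> R => x i0 ^+ k.*2) = fun x => (\sum_i (i == i0)%:R * x i) ^+ k.*2.
    apply/funext => x; rewrite (bigD1 i0) //= eqxx mul1r big1 ?addr0 // => i /negbTE ->.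
    by rewrite mul0r.
  exact: sph_ok_power.
have b0 : bounded1 (fun _ : 'I_n -> R => 0).
  split; first exact: pmeasurable_cst.
  by exists 0 => // x; rewrite normr0 mul0r.
rewrite /sph_mean mulrA; congr (_ * _).
have cvH := lin_change_unit dH0.
have F0 y : (0 <= (ball_ext (fun x => (\sum_i v i * x i) ^+ k.*2) y)%:E)%E.
  rewrite lee_fin /ball_ext mulr_ge0 ?indic_ballE //.
  by rewrite -mul2n exprM exprn_ge0 // sqr_ge0.
rewrite -(cvH _ F0); last by apply: pmeasurable_EFin; case: (sph_bounded1 (sph_ok_power v k.*2)).
rewrite dH mul1e.
have -> : (fun x => (ball_ext (fun x => (\sum_i v i * x i) ^+ k.*2) x)%:E) \o mact H =
   (fun x => (r2 v ^+ k * ball_ext (fun x => x i0 ^+ k.*2) x + 0)%:E).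
  apply/funext => x /=; congr EFin; rewrite addr0 /ball_ext !indic_ballE eH mulrCA; congr (_ * _).
  have -> : \sum_i v i * (mact H x i / enorm x) = enorm v * (x i0 / enorm x).
    by rewrite mulrA -vH mulr_suml; apply: eq_bigr => i _; rewrite mulrA.
  by rewrite exprMn -mul2n exprM sqr_enorm.
rewrite /leb_int iter_int_linear ?enum_uniq //; last exact: sph_bounded1.
have -> : iter_int (enum 'I_n) (fun _ : 'I_n -> R => 0%:E) (fun=> 0) = 0%E.
  have := @iter_int_box R 'I_n (enum 'I_n) 0 (fun=> 0) 0 (fun=> 0) (lexx _) (lexx _) (enum_uniq _).
  by rewrite !mul0r => h; rewrite -[RHS]h; apply: eq_iter_int => z; rewrite mul0r.
rewrite adde0 fineM //; exact: leb_int_fin (sph_bounded1 ok0).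
Qed.

End Rotation.

(** * Affine coordinates on the hyperplane *)

Section OperatorDeterminant.
Context {R : realType} {J : finType}.
Implicit Types (u v : J -> R) (L E : (J -> R) -> J -> R).

Definition linear_op L :=
  forall a u v, L (fun e => a * u e + v e) = fun e => a * L u e + L v e.

Lemma linear_op0 L : linear_op L -> L (fun=> 0) = fun=> 0.
Proof.
move=> hL; have := hL (-1) (fun=> 0) (fun=> 0).
rewrite (_ : (fun e : J => -1 * 0 + 0) = fun=> 0); last by apply/funext => e; rewrite mulr0 addr0.
move=> h; apply/funext => e; have := congr1 (fun f => f e) h => /= h'.
by rewrite h' mulN1r addNr.
Qed.

Lemma linear_op_sum L (K : Type) (l : seq K) (a : K -> R) (u : K -> J -> R) :
  linear_op L ->
  L (fun e => \sum_(k <- l) a k * u k e) = fun e => \sum_(k <- l) a k * L (u k) e.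
Proof.
move=> hL; elim: l => [|k l IH].
  rewrite (_ : (fun e => _) = fun=> 0); last by apply/funext => e; rewrite big_nil.
  by rewrite linear_op0 //; apply/funext => e; rewrite big_nil.
rewrite (_ : (fun e => _) = fun e => a k * u k e + \sum_(k <- l) a k * u k e); last first.
  by apply/funext => e; rewrite big_cons.
by rewrite hL IH; apply/funext => e; rewrite big_cons.
Qed.

Definition opmx L : 'M[R]_#|J| :=
  \matrix_(i, j) L (fun e => (e == enum_val j)%:R) (enum_val i).

Lemma opmxE L u j : linear_op L ->
  L u j = mact (opmx L) (fun i => u (enum_val i)) (enum_rank j).
Proof.
move=> hL.
have {1}-> : u = fun e => \sum_(i < #|J|) u (enum_val i) * (e == enum_val i)%:R.
  apply/funext => e; rewrite (bigD1 (enum_rank e)) //= enum_rankK eqxx mulr1 big1 ?addr0 // => i hi.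
  by case: eqP => [h|_]; rewrite ?mulr0 //; rewrite h enum_valK eqxx in hi.
rewrite (linear_op_sum _ (fun i : 'I_#|J| => u (enum_val i)) (fun i e => (e == enum_val i)%:R) hL).
by rewrite /mact; apply: eq_bigr => i _; rewrite !mxE enum_rankK mulrC.
Qed.

Lemma linear_opchain E eps i : linear_op E -> linear_op (opchain E eps i).
Proof.
move=> hE; elim: i => [|i IH] a u v //=; apply/funext => e.
by rewrite IH hE; ring.
Qed.

Lemma opmx_chain E eps i : linear_op E -> opmx (opchain E eps i) = chain (opmx E) eps i.
Proof.
move=> hE; elim: i => [|i IH] /=.
  by apply/matrixP => a b; rewrite !mxE (inj_eq enum_val_inj).
rewrite -IH; apply/matrixP => a b; rewrite !mxE (opmxE _ _ hE) /mact; congr (_ - _).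
by apply: eq_bigr => l _; rewrite !mxE !enum_valK.
Qed.

(** Transfers [chain_det] to operators on functions: [M] is the matrix of the whole sum in the
    standard basis. *)
Lemma op_det E (eps a : nat -> R) K : linear_op E ->
  (forall i j, (i < j)%N -> (j <= K)%N -> eps i < eps j) ->
  (forall i, 0 <= a i) ->
  (forall u, opchain E eps K.+1 u = fun=> 0) ->
  exists M : 'M[R]_#|J|, a 0%N ^+ #|J| <= \det M /\
    forall u j, \sum_(i < K.+1) a i * opchain E eps i u j =
       mact M (fun i => u (enum_val i)) (enum_rank j).
Proof.
move=> hE hinc ha h0; exists (\sum_(i < K.+1) a i *: chain (opmx E) eps i); split.
  apply: chain_det => //; rewrite -opmx_chain //.
  by apply/matrixP => i j; rewrite mxE h0 mxE.
move=> u j; rewrite /mact; under [RHS]eq_bigr => l _.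
  rewrite summxE mulr_suml; over.
rewrite exchange_big; apply: eq_bigr => i _ /=.
rewrite (opmxE _ _ (linear_opchain eps i hE)) opmx_chain // /mact mulr_sumr.
by apply: eq_bigr => l _; rewrite mxE mulrA.
Qed.
End OperatorDeterminant.

Section AffineChange.
Context {R : realType} {J : finType}.

Lemma iter_int_shift (b x : J -> R) s F : (forall y, (0 <= F y)%E) -> pmeasurable F ->
  iter_int s (fun u => F (fun j => u j + b j)) x = iter_int s F (fun j => x j + b j).
Proof.
move=> F0 gF; elim: s x => //= i s IH x.
under eq_integral => t _ do rewrite IH.
have E t : iter_int s F (fun j => upd x i t j + b j) =
    iter_int s F (upd (fun j => x j + b j) i (1 * t + b i)).
  by congr iter_int; apply/funext => j; rewrite /upd mul1r; case: eqP => // ->.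
under eq_integral => t _ do rewrite E.
have := @integral_affine R (fun t => iter_int s F (upd (fun j => x j + b j) i t)) 1 (b i).
rewrite oner_neq0 normr1 mul1e => -> //.
- by apply: pmeasurable_line; apply: pmeasurable_iter_int.
- by move=> t; apply: iter_int_ge0.
Qed.

Lemma leb_int_shift (b : J -> R) F : (forall y, (0 <= F y)%E) -> pmeasurable F ->
  leb_int (fun u : J -> R => F (fun j => u j + b j)) = leb_int F.
Proof.
move=> F0 gF; rewrite /leb_int iter_int_shift //; apply: iter_int_eq_on => j.
by rewrite mem_enum.
Qed.

Lemma leb_int_affine (A : 'M[R]_#|J|) (b : J -> R) F : \det A != 0 ->
  (forall y, (0 <= F y)%E) -> pmeasurable F ->
  (`|\det A|%:E * leb_int (fun u : J -> R =>
     F (fun j => mact A (fun i => u (enum_val i)) (enum_rank j) + b j)%R) = leb_int F)%E.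
Proof.
move=> dA F0 gF; rewrite -(leb_int_shift b F0 gF).
pose F1 := fun u : J -> R => F (fun j => u j + b j).
have gF1 : pmeasurable F1.
  apply: pmeasurable_comp => // j d T phi mphi; apply: measurable_funD; first exact: mphi.
  exact: measurable_cst.
pose F2 := fun y : 'I_#|J| -> R => F1 (fun j => y (enum_rank j)).
have gF2 : pmeasurable F2 by apply: pmeasurable_comp => // j; exact: pmeasurable_coord.
have F20 y : (0 <= F2 y)%E by apply: F0.
have -> : leb_int (fun u : J -> R => F (fun j => u j + b j)) = leb_int F2.
  rewrite -(@leb_int_relabel R J 'I_#|J| enum_val enum_rank F2) //.
  - congr leb_int; apply/funext => u; rewrite /F2 /F1; congr F; apply/funext => j.
    by rewrite enum_rankK.
  - exact: enum_valK.
  - exact: enum_rankK.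
rewrite -(lin_change_unit dA F20 gF2); congr (_ * _)%E.
rewrite -(@leb_int_relabel R J 'I_#|J| enum_val enum_rank (F2 \o mact A)) //.
- exact: enum_valK.
- exact: enum_rankK.
- by move=> y; apply: F20.
- by apply: pmeasurable_comp => // j; apply: pmeasurable_lin.
Qed.
End AffineChange.

(** * The spherical mean as a functional on forms *)

Section SphereOnForms.
Context {R : realType} (n k : nat).
Hypotheses (hn : (1 < n)%N) (hk : (0 < k)%N).
Local Notation D := (Mon n k.*2 -> R).
Implicit Types (c : D) (x : 'I_n -> R) (e : Mon n k.*2).

Definition monf e x : R := \prod_(i < n) x i ^+ tnth (val e) i.

Lemma sph_ok_monf e : sph_ok (monf e).
Proof.
split.
  move=> d T phi mphi; apply: (@measurable_prod _ _ _ _ _ _ (fun i t => phi t i ^+ tnth (val e) i)) => i _.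
  exact: measurable_funX.
exists 1 => // x hx; rewrite normr_prod; apply: prodr_ile1 => i _.
by rewrite normr_ge0 normrX exprn_ile1.
Qed.

Definition sph_form c : R := \sum_e c e * sph_mean (monf e).

Lemma sphere_int_ev c : sphere_int (ev c) = (sph_form c)%:E.
Proof. exact: (sphere_int_sum c sph_ok_monf). Qed.

Lemma sph_form_lin (a : R) c c' : sph_form (fun e => a * c e + c' e) = a * sph_form c + sph_form c'.
Proof.
by rewrite /sph_form mulr_sumr -big_split; apply: eq_bigr => e _ /=; ring.
Qed.

Lemma sph_form_powers c (I : finType) (b : I -> R) (t : I -> 'I_n -> R) (i0 : 'I_n) :
  (forall x, ev c x = \sum_v b v * (\sum_i t v i * x i) ^+ k.*2) ->
  sph_form c = (\sum_v b v * r2 (t v) ^+ k) * sph_mean (fun x => x i0 ^+ k.*2).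
Proof.
move=> h; apply: EFin_inj; rewrite -sphere_int_ev.
have -> : ev c = fun x => \sum_v b v * (\sum_i t v i * x i) ^+ k.*2 by apply/funext.
rewrite (@sphere_int_sum _ _ I b (fun v x => (\sum_i t v i * x i) ^+ k.*2)); last first.
  by move=> v; apply: sph_ok_power.
by rewrite mulr_suml; congr EFin; apply: eq_bigr => v _; rewrite (sph_mean_power _ i0) mulrA.
Qed.

Lemma linear_Eop : linear_op (@FormOps.Eop R n k).
Proof. by move=> a u v; rewrite FormOps.Eop_lin. Qed.

(** The determinant is at least a power of a_0 > 0. Together with the quadrature formula for m = k,
    surjectivity says that the 2k-th powers of linear forms span. *)
Lemma Lop_surj c : exists g, @FormOps.Lop R n k k g = c.
Proof.
have [M [hM h]] := @op_det R _ _ (Forms.epsl R n k) (Forms.acoef R k k) k linear_Eop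
  (fun i j => @epsl_lt R n k i j hn) (fun i => ltW (acoef_gt0 R k k i)) (@FormOps.opchain_Eop R n k).
have uM : M \in unitmx.
  rewrite unitmxE unitfE gt_eqF //; apply: lt_le_trans hM.
  by rewrite exprn_gt0 // acoef_gt0.
exists (fun e => mact (invmx M) (fun i => c (enum_val i)) (enum_rank e)).
apply/funext => e; rewrite /FormOps.Lop h.
have -> : (fun i => mact (invmx M) (fun i => c (enum_val i)) (enum_rank (enum_val i))) =
    mact (invmx M) (fun i => c (enum_val i)).
  by apply/funext => i; rewrite enum_valK.
by rewrite -mact_mul mulmxV // mact1 enum_rankK.
Qed.

Let i0 : 'I_n := Ordinal (ltnW hn).

(* Both functionals are determined by their values on powers of linear forms,
   which span, and there both are multiples of [r2]. *)
Lemma sph_form_quadrature (I : finType) (W : I -> R) (t : I -> 'I_n -> R) kap :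
  0 < kap ->
  (forall x, \sum_v W v * (\sum_i x i * t v i) ^+ k.*2 = kap * r2 x ^+ k) ->
  forall c, sph_form c = sph_mean (fun x => x i0 ^+ k.*2) / kap * \sum_v W v * ev c (t v).
Proof.
move=> kap0 hkap c; have [g <-] := Lop_surj c.
have [I' [W' [t' [q [_ hL hq _]]]]] := @FormOps.Lop_coef R n k.
pose b v := W' v * ev g (t' v) * ((k.*2)`!%:R)^-1.
have h x : ev (FormOps.Lop k g) x = \sum_v b v * (\sum_i t' v i * x i) ^+ k.*2.
  rewrite {1}/ev; under eq_bigr do rewrite hL mulr_suml.
  rewrite exchange_big; apply: eq_bigr => v _ /=.
  have -> : b v = W' v * FormOps.evr g (t' v) * ((k.*2)`!%:R)^-1 by [].
  rewrite -mulrA -hq; move: (W' v * FormOps.evr g (t' v)) => y.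
  rewrite /FormOps.evr mulr_sumr; apply: eq_bigr => e _.
  by rewrite mulrA.
rewrite (sph_form_powers i0 h).
have -> : \sum_v W v * ev (FormOps.Lop k g) (t v) = kap * \sum_v b v * r2 (t' v) ^+ k.
  under eq_bigr do rewrite h mulr_sumr.
  rewrite exchange_big mulr_sumr; apply: eq_bigr => v _ /=.
  rewrite mulrCA -hkap mulr_sumr; apply: eq_bigr => u _.
  by rewrite mulrCA.
by field; rewrite gt_eqF.
Qed.

(** Carried over from the quadrature, to which the spherical mean is proportional. *)
Lemma sph_form_Eop c : sph_form (FormOps.Eop c) = Forms.epsl R n k k * sph_form c.
Proof.
have [I [W [t [_ _ hE [kap kap0 hkap]]]]] := @FormOps.quadrature_identities R n k k (leqnn k).
by rewrite !(sph_form_quadrature kap0 hkap) [\sum_v _]hE; ring.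
Qed.

Lemma sph_form_opchain i c : (i <= k)%N ->
  sph_form (opchain (@FormOps.Eop R n k) (Forms.epsl R n k) i c) =
  \prod_(l < i) (Forms.epsl R n k k - Forms.epsl R n k l) * sph_form c.
Proof.
elim: i => [|i IH] hi; first by rewrite big_ord0 mul1r.
have -> : opchain (@FormOps.Eop R n k) (Forms.epsl R n k) i.+1 c =
   fun e => - Forms.epsl R n k i * opchain (@FormOps.Eop R n k) (Forms.epsl R n k) i c e
     + FormOps.Eop (opchain (@FormOps.Eop R n k) (Forms.epsl R n k) i c) e.
  by apply/funext => e /=; ring.
by rewrite sph_form_lin sph_form_Eop IH ?(ltnW hi) // big_ord_recr /=; ring.
Qed.

Lemma sph_form_Lop m c : sph_form (FormOps.Lop m c) = c0const R n k m * sph_form c.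
Proof.
transitivity (\sum_(i < k.+1) Forms.acoef R k m i *
   sph_form (opchain (@FormOps.Eop R n k) (Forms.epsl R n k) i c)).
  rewrite /sph_form /FormOps.Lop; under eq_bigr do rewrite mulr_suml.
  rewrite exchange_big; apply: eq_bigr => i _ /=; rewrite mulr_sumr.
  by apply: eq_bigr => e _; rewrite -mulrA.
rewrite /c0const mulr_suml; apply: eq_bigr => i _.
by rewrite sph_form_opchain ?mulrA // -ltnS.
Qed.

End SphereOnForms.

(** * The coordinates [proj_rest] and their inverse *)

Section HyperplaneCoordinates.
Context {R : realType} (n k : nat).
Hypotheses (hn : (1 < n)%N) (hk : (0 < k)%N).
Local Notation D := (Mon n k.*2 -> R).
Local Notation U := (MonRest n k.*2 -> R).
Implicit Types (c : D) (x : 'I_n -> R) (e : Mon n k.*2) (u w : U).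

Let i0 : 'I_n := Ordinal (ltnW hn).

Definition pure_tuple (i1 : 'I_n) : n.-tuple 'I_k.*2.+1 :=
  [tuple (if i == i1 then ord_max else ord0) | i < n].

Fact pure_tupleP i1 : \sum_(i < n) (tnth (pure_tuple i1) i : nat) == k.*2.
Proof.
rewrite (bigD1 i1) //= tnth_mktuple eqxx big1 => [|i hi]; first by rewrite addr0.
by rewrite tnth_mktuple (negbTE hi).
Qed.

Definition pure_mon i1 : Mon n k.*2 := exist _ (pure_tuple i1) (pure_tupleP i1).

Definition e0 : Mon n k.*2 := pure_mon i0.

Lemma first_pureE e : is_first_pure e = (e == e0).
Proof.
apply/existsP/eqP => [[i /andP[/eqP hi /eqP he]]|->]; last first.
  by exists i0; rewrite /= tnth_mktuple !eqxx.
have {hi} ei : i = i0 by apply/val_inj.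
rewrite ei in he.
apply/val_inj/eq_from_tnth => j; apply/val_inj; rewrite /= tnth_mktuple.
have hs : (\sum_(i < n) (tnth (val e) i : nat))%N = k.*2 := eqP (valP e).
move/eqP: hs; rewrite (bigD1 i0) //= he -[X in _ == X]addn0 eqn_add2l sum_nat_eq0.
case: eqP => [->|/eqP ji /forallP /(_ j)]; first by rewrite he.
by rewrite ji /= => /eqP.
Qed.

Lemma monf_e0 : monf e0 = (fun x : 'I_n -> R => x i0 ^+ k.*2).
Proof.
apply/funext => x; rewrite /monf (bigD1 i0) //= tnth_mktuple eqxx big1 ?mulr1 // => i hi.
by rewrite tnth_mktuple (negbTE hi).
Qed.

Definition S0 : R := sph_mean (monf e0).

Lemma S0_gt0 : 0 < S0.
Proof.
have h := @sph_ok_monf R n k e0.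
by rewrite /S0 monf_e0 in h *; apply: sph_mean_coord_gt0 => //; exact: ltnW.
Qed.

Lemma sum_split (F : Mon n k.*2 -> R) :
  \sum_e F e = F e0 + \sum_(r : MonRest n k.*2) F (val r).
Proof.
rewrite (bigD1 e0) //=; congr (_ + _).
rewrite (reindex_omap val (insub : _ -> option (MonRest n k.*2))) /=; last first.
  by move=> e he; rewrite insubT ?first_pureE.
by apply: eq_bigl => r; rewrite -first_pureE (valP r) valK eqxx.
Qed.

(** The inverse of [proj_rest] on forms of mean zero, the direction of M. Where [insub] fails the
    monomial is x_1^(2k), whose coefficient is solved from the vanishing of the mean. *)
Definition sec0 u : D := fun e =>
  if insub e is Some r then u r else - (\sum_(r : MonRest n k.*2) u r * sph_mean (monf (val r))) / S0.

(** The affine inverse onto M itself, with x_1^(2k) divided by its mean as base point. *)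
Definition sec u : D := fun e => sec0 u e + (e == e0)%:R / S0.

Lemma sec0_val u (r : MonRest n k.*2) : sec0 u (val r) = u r.
Proof. by rewrite /sec0 valK. Qed.

Lemma sec0_e0 u : sec0 u e0 = - (\sum_(r : MonRest n k.*2) u r * sph_mean (monf (val r))) / S0.
Proof. by rewrite /sec0 insubF // first_pureE eqxx. Qed.

Lemma rest_neq (r : MonRest n k.*2) : (val r == e0) = false.
Proof. by apply/negbTE; rewrite -first_pureE (valP r). Qed.

Lemma sec_val u (r : MonRest n k.*2) : sec u (val r) = u r.
Proof. by rewrite /sec sec0_val rest_neq mul0r addr0. Qed.

Lemma sph_form_sec0 u : sph_form (sec0 u) = 0.
Proof.
rewrite /sph_form sum_split sec0_e0 -/S0 divfK ?gt_eqF ?S0_gt0 //.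
by under [X in _ + X]eq_bigr do rewrite sec0_val; rewrite addNr.
Qed.

Lemma sph_form_sec u : sph_form (sec u) = 1.
Proof.
have -> : sec u = fun e => 1 * sec0 u e + (e == e0)%:R / S0.
  by apply/funext => e; rewrite mul1r.
rewrite sph_form_lin sph_form_sec0 mulr0 add0r /sph_form (bigD1 e0) //= eqxx big1 ?addr0 => [|e /negbTE ->].
  by rewrite -/S0 mul1r mulVf // gt_eqF // S0_gt0.
by rewrite !mul0r.
Qed.

Lemma proj_rest_sec u : proj_rest (sec u) = u.
Proof. by apply/funext => r; rewrite /proj_rest sec_val. Qed.

Lemma proj_rest_sec0 u : proj_rest (sec0 u) = u.
Proof. by apply/funext => r; rewrite /proj_rest sec0_val. Qed.

Lemma sph_form_inj c c' : sph_form c = sph_form c' -> proj_rest c = proj_rest c' -> c = c'.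
Proof.
move=> hS hp.
have hr (r : MonRest n k.*2) : c (val r) = c' (val r) by have := congr1 (fun f => f r) hp.
apply/funext => e; have [/eqP ->|ne] := boolP (e == e0); last first.
  have ne' : ~~ is_first_pure e by rewrite first_pureE.
  by rewrite -[e]/(val (Sub e ne' : MonRest n k.*2)) hr.
move: hS; rewrite /sph_form !sum_split.
under eq_bigr do rewrite hr.
by move=> /addIr /mulIf; apply; rewrite gt_eqF // S0_gt0.
Qed.

Lemma secK c : sph_form c = 1 -> sec (proj_rest c) = c.
Proof. by move=> h; apply: sph_form_inj; rewrite ?sph_form_sec ?proj_rest_sec. Qed.

Lemma sec0K c : sph_form c = 0 -> sec0 (proj_rest c) = c.
Proof. by move=> h; apply: sph_form_inj; rewrite ?sph_form_sec0 ?proj_rest_sec0. Qed.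

Lemma volME (X : set D) : volM X = leb_int (fun u => (\1_[set u | X (sec u)] u)%:E).
Proof.
rewrite /volM /leb_vol; congr leb_int; apply/funext => u; congr ((\1_ _ _)%:E).
apply/seteqP; split => w /=.
  move=> [c [Xc]]; rewrite /Mhyp /= sphere_int_ev => -[hc] <-.
  by rewrite secK.
move=> Xw; exists (sec w); last exact: proj_rest_sec.
by split => //; rewrite /Mhyp /= sphere_int_ev sph_form_sec.
Qed.

Lemma card_MonRest : #|{: MonRest n k.*2}| = alpha n k.*2.
Proof.
rewrite /alpha subn1 [LHS]card_sig; transitivity #|predC1 e0|; last exact: cardC1.
by apply: eq_card => e; rewrite [LHS]inE [RHS]inE /= -first_pureE.
Qed.

Lemma alpha_gt0 : (0 < alpha n k.*2)%N.
Proof.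
rewrite -card_MonRest; pose i1 : 'I_n := Ordinal hn.
have h : ~~ is_first_pure (pure_mon i1).
  rewrite first_pureE; apply/eqP => /(congr1 (fun e : Mon n k.*2 => tnth (val e) i1 : nat)).
  by rewrite /= !tnth_mktuple eqxx /= => h; move: hk; rewrite -double_gt0 h.
by apply/card_gt0P; exists (Sub (pure_mon i1) h).
Qed.

Lemma sec0_lin (a : R) u w : sec0 (fun r => a * u r + w r) = fun e => a * sec0 u e + sec0 w e.
Proof.
apply: sph_form_inj.
  by rewrite sph_form_lin !sph_form_sec0 mulr0 addr0.
by rewrite proj_rest_sec0; apply/funext => r; rewrite /proj_rest !sec0_val.
Qed.

Lemma pmeasurable_sec e : pmeasurable (fun u => sec u e : measurableTypeR R).
Proof.
move=> d T phi mphi; rewrite /comp /sec.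
apply: measurable_funD; last exact: measurable_cst.
rewrite /sec0; case: insub => [r|]; first exact: mphi.
apply: measurable_funM; last exact: measurable_cst.
apply: measurable_funN.
apply: (@measurable_sum _ _ _ _ _ _ (fun r t => phi t r * sph_mean (monf (val r)))) => r.
by apply: measurable_funM; [exact: mphi | exact: measurable_cst].
Qed.

Lemma pmeasurable_ev_sec x : pmeasurable (fun u => ev (sec u) x : measurableTypeR R).
Proof.
move=> d T phi mphi.
apply: (@measurable_sum _ _ _ _ _ _ (fun e t => sec (phi t) e * \prod_(i < n) x i ^+ tnth (val e) i)) => e.
by apply: measurable_funM; [exact: pmeasurable_sec mphi | exact: measurable_cst].
Qed.
End HyperplaneCoordinates.

Import numFieldNormedType.Exports.

(** * Functional equation of Gamma *)

Section GammaFunction.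
Context {R : realType}.
Notation mu := (@lebesgue_measure R).

Lemma continuous_expN : continuous (fun z : R => expR (- z)).
Proof.
move=> z; apply: continuous_comp; last exact: continuous_expR.
exact: (@continuousN _ R^o).
Qed.

Lemma integral_expN (u : R) :
  (\int[mu]_(t in `[u, +oo[) (expR (- t))%:E = (expR (- u))%:E)%E.
Proof.
rewrite (@ge0_continuous_FTC2y _ _ (fun x => - expR (- x)) _ 0) //.
- by rewrite EFinN oppeK add0e.
- by apply: continuous_subspaceT; exact: continuous_expN.
- by rewrite -oppr0; apply: cvgN; exact: cvgr_expR.
- by apply: cvgN; apply/cvg_at_right_filter; exact: continuous_expN.
- move=> z _; rewrite derive1_comp// derive1N// derive1_id mulN1r derive1_comp// derive1E.
  have /funeqP -> := @derive_expR R.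
  by rewrite derive1N // derive1_id mulrN mulr1 opprK.
Qed.

Lemma powR_continuous_pos (p x : R) : 0 < x -> {for x, continuous (fun z => powR z p)}.
Proof.
move=> x0; apply: differentiable_continuous; apply/derivable1_diffP.
by apply: derivable_powR; rewrite in_itv /= andbT.
Qed.

Lemma powR_cvg_at0 (p : R) : 0 < p -> powR z p @[z --> 0^'+] --> powR 0 p.
Proof. by move=> p0; rewrite powR0 ?gt_eqF //; apply: powR_cvg0. Qed.

Lemma integral_powR (s t : R) : 1 < s -> 0 < t ->
  (\int[mu]_(u in `[0%R, t]) (s * powR u (s - 1))%:E = (powR t s)%:E)%E.
Proof.
move=> s1 t0; have s0 : 0 < s by lra.
have sm : 0 < s - 1 by lra.
rewrite (@continuous_FTC2 _ _ (fun x => powR x s)) //.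
- by rewrite powR0 ?gt_eqF // sube0.
- apply/(continuous_within_itvP _ t0); split.
  + move=> x; rewrite in_itv /= => /andP[x0 _].
    by apply: (@continuousM _ R^o (fun=> s) (fun u => powR u (s - 1))); [exact: cst_continuous | exact: powR_continuous_pos].
  + by apply: cvgMr => //; exact: powR_cvg_at0.
  + apply/cvg_at_left_filter.
    by apply: (@continuousM _ R^o (fun=> s) (fun u => powR u (s - 1))); [exact: cst_continuous | exact: powR_continuous_pos].
- split.
  + by move=> x; rewrite in_itv /= => /andP[x0 _]; apply: derivable_powR; rewrite in_itv /= andbT.
  + exact: powR_cvg_at0.
  + by apply/cvg_at_left_filter; exact: powR_continuous_pos.
- by move=> x; rewrite in_itv /= => /andP[x0 _]; rewrite powR_derive1 // in_itv /= andbT.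
Qed.

Let gterm (s : R) (z : R * R) : \bar R :=
  (((0 <= z.1) && (z.1 <= z.2))%:R * (s * powR z.1 (s - 1) * expR (- z.2)))%:E.

(** Tonelli for s u^(s-1) exp(-t) on the region 0 <= u <= t: integrating over u first gives t^s
    exp(-t), integrating over t first gives s u^(s-1) exp(-u). The condition s > 1 keeps u^(s-1)
    continuous at 0. *)
Lemma Gamma_step (s : R) : 1 < s ->
  (\int[mu]_(t in `]0%R, +oo[) (powR t (s + 1 - 1) * expR (- t))%:E =
   s%:E * \int[mu]_(t in `]0%R, +oo[) (powR t (s - 1) * expR (- t))%:E)%E.
Proof.
move=> s1; have s0 : 0 < s by lra.
have sm : s - 1 != 0 by apply: lt0r_neq0; lra.
have mg : measurable_fun setT (gterm s : measurableTypeR R * measurableTypeR R -> _).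
  apply/measurable_EFinP; apply: measurable_funM.
    rewrite (_ : (fun _ => _) = fun z : R * R => if (0 <= z.1) && (z.1 <= z.2) then 1 else 0); last first.
      by apply/funext => z; case: (_ && _).
    apply: measurable_fun_ifT; [|exact: measurable_cst|exact: measurable_cst].
    apply: measurable_and; apply: measurable_fun_ler => //.
  apply: measurable_funM.
    apply: measurable_funM => //.
    by apply: (measurableT_comp (measurable_powR (s - 1))).
  apply: (measurableT_comp (@measurable_expR R)).
  by apply: measurable_funN.
have g0 z : (0 <= gterm s z)%E.
  by rewrite lee_fin mulr_ge0 // mulr_ge0 ?expR_ge0 // mulr_ge0 ?powR_ge0 // ltW.
have := @fubini_tonelli _ _ _ _ _ mu mu (gterm s) mg g0.
have -> : (\int[mu]_x \int[mu]_y gterm s (x, y) =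
   s%:E * \int[mu]_(t in `]0%R, +oo[) (powR t (s - 1) * expR (- t))%:E)%E.
  rewrite -ge0_integralZl_EFin //; last 3 first.
  - by move=> t _; rewrite lee_fin mulr_ge0 ?powR_ge0 ?expR_ge0.
  - apply/measurable_EFinP; apply: measurable_funTS; apply: measurable_funM.
      exact: measurable_powR.
    by apply: (measurableT_comp (@measurable_expR R)).
  - exact: ltW.
  rewrite [RHS]integral_mkcond; apply: eq_integral => x _; rewrite patchE.
  case: (ltgtP 0 x) => x0.
  - rewrite ifT ?inE /= ?in_itv /= ?x0 //.
    transitivity (\int[mu]_y ((s * powR x (s - 1))%:E * ((fun t => (expR (- t))%:E) \_ `[x, +oo[) y))%E.
      apply: eq_integral => y _; rewrite /gterm /= (ltW x0) /= patchE mem_setE in_itv /= andbT.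
      by case: (x <= y); rewrite ?mul1r ?mul0r ?mule0 // EFinM.
    rewrite ge0_integralZl_EFin //; last 3 first.
    + by move=> t _; rewrite patchE; case: ifP => // _; rewrite lee_fin expR_ge0.
    + apply/measurable_restrict => //; apply: measurable_funTS; apply/measurable_EFinP.
      by apply: (measurableT_comp (@measurable_expR R)).
    + by rewrite mulr_ge0 ?powR_ge0 // ltW.
    rewrite -integral_mkcond integral_expN -!EFinM; congr EFin; ring.
  - rewrite ifF; last by apply/negbTE; rewrite mem_setE in_itv /= andbT -leNgt ltW.
    by apply: integral0_eq => y _; rewrite /gterm /= leNgt x0 /= mul0r.
  - rewrite ifF; last by apply/negbTE; rewrite mem_setE in_itv /= andbT -x0 ltxx.
    by apply: integral0_eq => y _; rewrite /gterm /= -x0 powR0 // mulr0 !mul0r mulr0.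
move=> ->; rewrite integral_mkcond; apply: eq_integral => t _; rewrite patchE addrK.
case: (ltP 0 t) => t0.
- rewrite ifT ?inE /= ?in_itv /= ?t0 //.
  transitivity (\int[mu]_x ((expR (- t))%:E * ((fun u => (s * powR u (s - 1))%:E) \_ `[0%R, t]) x))%E.
    rewrite ge0_integralZl_EFin ?expR_ge0 //; last 2 first.
    + by move=> u _; rewrite patchE; case: ifP => // _; rewrite lee_fin mulr_ge0 ?powR_ge0 // ltW.
    + apply/measurable_restrict => //; apply: measurable_funTS; apply/measurable_EFinP.
      by apply: measurable_funM => //; exact: measurable_powR.
    by rewrite -integral_mkcond integral_powR // -EFinM mulrC.
  apply: eq_integral => x _; rewrite /gterm /= patchE mem_setE in_itv /=.
  by case: (_ && _); rewrite ?mul1r ?mul0r ?mule0 // -EFinM mulrC.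
- rewrite ifF; last by apply/negbTE; rewrite mem_setE in_itv /= andbT -leNgt.
  symmetry; apply: integral0_eq => x _; rewrite /gterm /=.
  case: (leP 0 x) => x0 /=; last by rewrite mul0r.
  case: (leP x t) => xt; last by rewrite mul0r.
  have -> : x = 0 by lra.
  by rewrite powR0 // mulr0 mul0r mulr0.
Qed.

Lemma GammaS (s : R) : 1 < s -> Gamma (s + 1) = s * Gamma s.
Proof.
move=> s1; rewrite /Gamma Gamma_step //.
(* Should the integral be infinite, both real values are 0 and the identity still holds. *)
set X := (\int[mu]_(t in _) _)%E.
have : (0 <= X)%E.
  by apply: integral_ge0 => t _; rewrite lee_fin mulr_ge0 ?powR_ge0 ?expR_ge0.
case: X => [x|_|//] /=; first by [].
by rewrite gt0_muley ?lte_fin ?mulr0 //; lra.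
Qed.

End GammaFunction.

(** * Comparison of the volumes *)

Section PsdCone.
Context {R : realType} (n k : nat).
Hypotheses (hn : (1 < n)%N) (hk : (0 < k)%N).
Local Notation D := (Mon n k.*2 -> R).
Implicit Types (c : D) (x : 'I_n -> R) (e : Mon n k.*2).

Lemma cvg_prod_seq (I : Type) (s : seq I) (f : I -> nat -> R) (a : I -> R) :
  (forall i, f i m @[m --> \oo] --> a i) ->
  \prod_(i <- s) f i m @[m --> \oo] --> \prod_(i <- s) a i.
Proof.
move=> h; elim: s => [|i s IH].
  by rewrite big_nil; under eq_fun do rewrite big_nil; exact: cvg_cst.
by rewrite big_cons; under eq_fun do rewrite big_cons; apply: cvgM.
Qed.

Lemma cvg_sum_seq (I : Type) (s : seq I) (f : I -> nat -> R) (a : I -> R) :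
  (forall i, f i m @[m --> \oo] --> a i) ->
  \sum_(i <- s) f i m @[m --> \oo] --> \sum_(i <- s) a i.
Proof.
move=> h; elim: s => [|i s IH].
  by rewrite big_nil; under eq_fun do rewrite big_nil; exact: cvg_cst.
by rewrite big_cons; under eq_fun do rewrite big_cons; apply: cvgD.
Qed.

Lemma cvg_ev c x (u : nat -> 'I_n -> R) : (forall i, u m i @[m --> \oo] --> x i) ->
  ev c (u m) @[m --> \oo] --> ev c x.
Proof.
move=> h; apply: cvg_sum_seq => e; apply: cvgM; [exact: cvg_cst | apply: cvg_prod_seq => i].
  by apply: (cvg_comp (fun m => u m i) (fun y : R => y ^+ tnth (val e) i) (h i)); exact: exprn_continuous.
Qed.

Lemma rat_approx (y : R) : exists q : nat -> rat, ratr (q m) @[m --> \oo] --> y.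
Proof.
have H m : exists q : rat, ratr q \in `]y, (y + m.+1%:R^-1)[.
  by apply: rat_in_itvoo; rewrite ltrDl invr_gt0 ltr0n.
pose q m := projT1 (cid (H m)).
exists q; apply: (@squeeze_cvgr _ _ _ _ (fun=> y) (fun m => y + m.+1%:R^-1)).
- near=> m; have := projT2 (cid (H m)); rewrite -/(q m) in_itv /= => /andP[a b].
  by rewrite !ltW.
- exact: cvg_cst.
- rewrite -[X in _ --> X]addr0; apply: cvgD; [exact: cvg_cst | exact: cvg_harmonic].
Unshelve. all: end_near.
Qed.

(** By continuity; it exhibits the psd section as a countable intersection of measurable
    conditions. *)
Lemma psd_rat c : (forall q : {ffun 'I_n -> rat}, 0 <= ev c (fun i => ratr (q i))) -> Cpsd c.
Proof.
move=> h x; have [q hq] : exists q : 'I_n -> nat -> rat, forall i, ratr (q i m) @[m --> \oo] --> x i.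
  exists (fun i => projT1 (cid (rat_approx (x i)))) => i.
  exact: (projT2 (cid (rat_approx (x i)))).
have := @cvg_ev c x (fun m i => ratr (q i m)) hq.
move=> /cvgr_to_ge; apply; near=> m.
have := h [ffun i => q i m]; congr (0 <= ev c _).
by apply/funext => i; rewrite ffunE.
Unshelve. all: end_near.
Qed.

Definition psd_section : set (MonRest n k.*2 -> R) := [set u | Cpsd (sec hn u)].

Lemma measurable_psd_section d (T : measurableType d) (phi : T -> MonRest n k.*2 -> R) :
  (forall r, measurable_fun setT (fun t => phi t r)) ->
  measurable [set t | psd_section (phi t)].
Proof.
move=> mphi.
have -> : [set t | psd_section (phi t)] =
  \bigcap_(i in setT) [set t | if @unpickle {ffun 'I_n -> rat} i is Some q then
      0 <= ev (sec hn (phi t)) (fun i => ratr (q i)) else true].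
  apply/seteqP; split => t /=.
    by move=> h i _ /=; case: unpickle.
  by move=> h; apply: psd_rat => q; have := h (pickle q) Logic.I; rewrite /= pickleK.
apply: bigcapT_measurable => i; case: unpickle => [q|]; last by rewrite (_ : [set _ | _] = setT) //; apply/seteqP; split.
rewrite -[X in measurable X]setTI.
have m1 : measurable_fun setT (fun t => 0 <= ev (sec hn (phi t)) (fun i => ratr (q i))).
  by apply: measurable_fun_ler; [exact: measurable_cst | exact: pmeasurable_ev_sec mphi].
exact: (m1 measurableT [set true] ltac:(by [])).
Qed.

Lemma pmeasurable_psd_section : pmeasurable (fun u => (\1_psd_section u)%:E : \bar R).
Proof.
move=> d T phi mphi; apply/measurable_EFinP.
rewrite (_ : (fun _ => _) = \1_[set t | psd_section (phi t)]).
  by apply: measurable_indic; exact: measurable_psd_section.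
by apply/funext => t; rewrite !indicE; congr (_%:R); congr nat_of_bool.
Qed.

Lemma mon_le_r2 x e : `|\prod_(i < n) x i ^+ tnth (val e) i| <= r2 x ^+ k.
Proof.
have he : (\sum_(i < n) (tnth (val e) i : nat))%N = k.*2 := eqP (valP e).
have -> : r2 x ^+ k = \prod_(i < n) enorm x ^+ tnth (val e) i.
  by rewrite prodrXr he -mul2n exprM sqr_enorm.
rewrite normr_prod; apply: ler_prod => i _; rewrite normr_ge0 normrX.
by apply: lerXn2r; rewrite ?nnegrE ?enorm_ge0 //; exact: coord_le_enorm.
Qed.

Lemma r2_eq0 x : r2 x = 0 -> x = fun=> 0.
Proof.
move/eqP; rewrite psumr_eq0 => [/allP h|i _]; last exact: sqr_ge0.
apply/funext => i; have := h i; rewrite mem_index_enum sqrf_eq0 => /(_ isT)/eqP //.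
Qed.

(** Away from 0 one divides by r^(2(m-k)); at 0 all monomials of positive degree vanish. *)
Lemma Kcone_psd m c : Kcone m c -> Cpsd c.
Proof.
move=> [ls h] x.
have [x0|x0] := eqVneq (r2 x) 0.
  have := @mon_le_r2 x; rewrite x0 expr0n gtn_eqF // => hm.
  rewrite /ev sumr_ge0 // => e _; have := hm e; rewrite normr_le0 => /eqP ->.
  by rewrite mulr0.
have rp : 0 < r2 x by rewrite lt_neqAle eq_sym x0 r2_ge0.
rewrite -(@pmulr_rge0 _ (r2 x ^+ (m - k))) ?exprn_gt0 // h.
by apply: sumr_ge0 => a _; rewrite -mul2n exprM exprn_ge0 // sqr_ge0.
Qed.

(** Were the mean zero, every node of nonzero weight would be the origin, against the [kap] identity
    at the basis vector e_i0. *)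
Lemma sph_form_r2_gt0 c : (forall x, ev c x = r2 x ^+ k) -> 0 < sph_form c.
Proof.
move=> hc; pose i0 := Ordinal (ltnW hn).
have [I [W [t [W0 _ _ [kap kap0 hkap]]]]] := @FormOps.quadrature_identities R n k k (leqnn k).
rewrite (sph_form_quadrature hn kap0 hkap) mulr_gt0 //.
  apply: divr_gt0 => //; have := S0_gt0 (R := R) k hn; rewrite /S0 monf_e0.
  by congr (0 < sph_mean _).
have ge0 v : 0 <= W v * ev c (t v) by rewrite mulr_ge0 // hc exprn_ge0 // r2_ge0.
rewrite lt_neqAle eq_sym sumr_ge0 ?andbT //; apply/negP => /eqP s0.
have z v : W v * ev c (t v) = 0.
  apply/eqP; move/eqP: s0; rewrite psumr_eq0 => [/allP /(_ v)|//].
  by rewrite mem_index_enum => /(_ isT).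
have := hkap (fun i => (i == i0)%:R).
rewrite big1 => [/eqP|v _]; last first.
  have /eqP := z v; rewrite mulf_eq0 hc => /orP[/eqP ->|]; first by rewrite mul0r.
  rewrite expf_eq0 hk => /eqP /r2_eq0 ->.
  by rewrite big1 ?expr0n ?double_eq0 ?gtn_eqF ?mulr0 // => i _; rewrite mulr0.
rewrite eq_sym mulf_eq0 gt_eqF //= expf_eq0 hk /=.
rewrite /FormOps.r2r (bigD1 i0) //= ?eqxx expr1n big1 ?addr0 ?oner_eq0 // => i /negbTE ->.
by rewrite expr0n.
Qed.

(* Small perturbations of [r2 ^ k] are nonnegative. *)
Lemma volC_gt0 : exists2 a : R, 0 < a & (a%:E <= leb_int (fun u => (\1_psd_section u)%:E))%E.
Proof.
have [c hc] := @FormOps.r2_coef R n k.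
have hc' x : ev c x = r2 x ^+ k by exact: hc.
have s0 := sph_form_r2_gt0 hc'; set s := sph_form c in s0.
pose c1 : D := fun e => s^-1 * c e + 0.
have Sc1 : sph_form c1 = 1.
  rewrite /c1 (sph_form_lin _ _ (fun=> 0)) -/s mulVf ?gt_eqF //.
  by rewrite /sph_form big1 ?addr0 // => e _; rewrite mul0r.
pose u0 := proj_rest c1.
have su0 : sec hn u0 = c1 by apply: secK.
(* [B] bounds the coefficients of [sec0 w] when the coordinates of w are at most 1; the sum accounts
   for the coefficient of x_1^(2k). With N monomials, the radius r below satisfies N r B = 1/s, the
   factor of r^(2k) in [c1]. *)
pose B : R := 1 + (\sum_(r : MonRest n k.*2) `|sph_mean (monf (val r))|) / S0 (R := R) k hn.
have B1 : 1 <= B by rewrite /B lerDl divr_ge0 ?sumr_ge0 // ltW // S0_gt0.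
pose N : R := #|{: Mon n k.*2}|%:R.
have N0 : 0 < N by rewrite ltr0n; apply/card_gt0P; exists (e0 k hn).
pose r : R := (s * B * N)^-1.
have r0 : 0 < r by rewrite invr_gt0 !mulr_gt0 //; lra.
exists ((1 * (2 * r) ^+ #|{: MonRest n k.*2}|)).
  by rewrite mul1r exprn_gt0 // mulr_gt0.
apply: (@leb_int_ge_box _ _ _ _ u0) => //; first exact: ltW.
move=> u; rewrite mul1r indicE; case: (boolP (_ \in _)) => [/set_mem hu|_]; last first.
  by rewrite indicE; case: (_ \in _).
rewrite indicE mem_set //= => x.
pose w : MonRest n k.*2 -> R := fun q => -1 * u0 q + u q.
have Esec e : sec hn u e = c1 e + sec0 hn w e.
  rewrite -su0 /w sec0_lin /sec; ring.
have hw q : `|w q| <= r by have := hu q; rewrite /w mulN1r addrC.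
have hw0 e : `|sec0 hn w e| <= r * B.
  rewrite /sec0; case: insub => [q|].
    by apply: le_trans (hw q) _; rewrite ler_peMr // ltW.
  rewrite normrM normrN normfV (gtr0_norm (S0_gt0 (R := R) k hn)).
  rewrite /B mulrDr mulr1 -[leLHS]add0r lerD ?(ltW r0) // mulrA ler_wpM2r ?invr_ge0 ?(ltW (S0_gt0 (R := R) k hn)) //.
  apply: le_trans (ler_norm_sum _ _ _) _; rewrite mulr_sumr; apply: ler_sum => q _.
  by rewrite normrM ler_wpM2r.
have -> : ev (sec hn u) x = s^-1 * r2 x ^+ k + ev (sec0 hn w) x.
  rewrite -hc' /ev mulr_sumr -big_split; apply: eq_bigr => e _ /=.
  by rewrite Esec /c1; ring.
have hE : `|ev (sec0 hn w) x| <= s^-1 * r2 x ^+ k.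
  apply: le_trans (ler_norm_sum _ _ _) _.
  apply: (@le_trans _ _ (\sum_(e : Mon n k.*2) r * B * r2 x ^+ k)).
    apply: ler_sum => e _; rewrite normrM; apply: ler_pM => //; exact: mon_le_r2.
  rewrite sumr_const -[_ *+ _]mulr_natl -/N mulrA ler_wpM2r ?exprn_ge0 ?r2_ge0 //.
  rewrite /r le_eqVlt; apply/orP; left; apply/eqP; field.
  by rewrite !gt_eqF //; lra.
by have := ler_normlP _ _ hE => -[h1 h2]; lra.
Qed.

End PsdCone.

(** * The action of L / c_0 on the hyperplane and the volume inequality *)

Section VolumeComparison.
Context {R : realType} (n k : nat).
Hypotheses (hn : (1 < n)%N) (hk : (0 < k)%N).
Local Notation D := (Mon n k.*2 -> R).
Local Notation U := (MonRest n k.*2 -> R).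
Local Notation Eop := (@FormOps.Eop R n k).
Local Notation eps := (Forms.epsl R n k).
Implicit Types (c : D) (x : 'I_n -> R) (e : Mon n k.*2) (u w : U).

Lemma c0const_gt0 m : (k <= m)%N -> 0 < c0const R n k m.
Proof.
by move=> hkm; rewrite c0constE // divr_gt0 ?falling_gt0 //.
Qed.

Lemma sph_form_opchain0 c i : sph_form c = 0 -> sph_form (opchain Eop eps i c) = 0.
Proof.
move=> h; elim: i => [//|i IH].
have -> : opchain Eop eps i.+1 c =
   fun e => - eps i * opchain Eop eps i c e + Eop (opchain Eop eps i c) e.
  by apply/funext => e /=; ring.
by rewrite sph_form_lin (sph_form_Eop hn) IH !mulr0 addr0.
Qed.

(** E read in coordinates on mean-zero forms, a subspace that it preserves by [sph_form_Eop]. *)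
Definition Eop0 u : U := proj_rest (Eop (sec0 hn u)).

Lemma linear_Eop0 : linear_op Eop0.
Proof.
by move=> a u w; rewrite /Eop0 sec0_lin FormOps.Eop_lin.
Qed.

Lemma opchain_Eop0 i u : opchain Eop0 eps i u = proj_rest (opchain Eop eps i (sec0 hn u)).
Proof.
elim: i => [|i IH] /=; first by rewrite proj_rest_sec0.
apply/funext => r; rewrite IH /Eop0 sec0K //.
by apply: sph_form_opchain0; exact: sph_form_sec0.
Qed.

(** [f] is the indicator of the image of the psd section under L / c_0, written through the inverse
    map [psi]. In coordinates this map is [aff], whose linear part has determinant at least (a_0 /
    c_0)^alpha by [op_det]. *)
Lemma image_vol m : (k <= m)%N -> exists f : U -> R,
  [/\ forall w, 0 <= f w,
    (((Forms.acoef R k m 0 / c0const R n k m) ^+ #|{: MonRest n k.*2}|)%:E *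
       leb_int (fun u => (\1_(psd_section hn) u)%:E) <= leb_int (fun w => (f w)%:E))%E,
    forall w, f w <= 1 &
    forall w, f w != 0 -> exists c, [/\ Cpsd c, sph_form c = 1 &
      forall e, sec hn w e = (c0const R n k m)^-1 * FormOps.Lop m c e]].
Proof.
move=> hkm; have c0 := c0const_gt0 hkm; set C0 := c0const R n k m in c0 *.
pose a i := Forms.acoef R k m i / C0.
have a0 i : 0 <= a i by rewrite divr_ge0 ?ltW // acoef_gt0.
have hz u : opchain Eop0 eps k.+1 u = fun=> 0.
  by rewrite opchain_Eop0 FormOps.opchain_Eop.
have [M [hM hA]] := op_det linear_Eop0 (fun i j => @epsl_lt R n k i j hn) a0 hz.
have dM : 0 < \det M.
  by apply: lt_le_trans hM; rewrite exprn_gt0 // divr_gt0 // acoef_gt0.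
have uM : M \in unitmx by rewrite unitmxE unitfE gt_eqF.
pose T c : D := fun e => C0^-1 * FormOps.Lop m c e.
have ST c : sph_form (T c) = sph_form c.
  have -> : T c = fun e => C0^-1 * FormOps.Lop m c e + 0 * c e.
    by apply/funext => e; rewrite mul0r addr0.
  rewrite sph_form_lin (sph_form_Lop hn) -/C0.
  have -> : sph_form (fun e => 0 * c e) = 0 by rewrite /sph_form big1 // => e _; rewrite !mul0r.
  by rewrite addr0 mulKf // gt_eqF.
(* The base point of M, with [sec u] = [sec0 u] + [v0]; its image gives the translation part [b]. *)
pose v0 : D := fun e => (e == e0 k hn)%:R / S0 k hn.
pose b : U := proj_rest (T v0).
have TE c e : T c e = \sum_(i < k.+1) a i * opchain Eop eps i c e.
  by rewrite /T /FormOps.Lop mulr_sumr; apply: eq_bigr => i _; rewrite /a; ring.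
pose aff u : U := fun j => mact M (fun i => u (enum_val i)) (enum_rank j) + b j.
have secaff u : sec hn (aff u) = T (sec hn u).
  have -> : aff u = proj_rest (T (sec hn u)); last by rewrite secK // ST sph_form_sec.
  apply/funext => r; rewrite /aff -hA /b /proj_rest !TE -big_split; apply: eq_bigr => i _ /=.
  have -> : sec hn u = fun e => 1 * sec0 hn u e + v0 e.
    by apply/funext => e; rewrite mul1r.
  by rewrite (linear_opchain eps i (@linear_Eop R n k)) opchain_Eop0 mul1r mulrDr.
pose psi w : U := fun j =>
  mact (invmx M) (fun i => w (enum_val i) - b (enum_val i)) (enum_rank j).
have psiK u : psi (aff u) = u.
  apply/funext => j; rewrite /psi /aff.
  have -> : (fun i => mact M (fun i0 => u (enum_val i0)) (enum_rank (enum_val i)) +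
     b (enum_val i) - b (enum_val i)) = mact M (fun i0 => u (enum_val i0)).
    by apply/funext => i; rewrite addrK enum_valK.
  by rewrite -mact_mul mulVmx // mact1 enum_rankK.
have affK w : aff (psi w) = w.
  apply/funext => j; rewrite /psi /aff.
  have -> : (fun i => mact (invmx M) (fun i0 => w (enum_val i0) - b (enum_val i0)) (enum_rank (enum_val i)))
     = mact (invmx M) (fun i0 => w (enum_val i0) - b (enum_val i0)).
    by apply/funext => i; rewrite enum_valK.
  by rewrite -mact_mul mulmxV // mact1 enum_rankK subrK.
pose f w : R := \1_(psd_section hn) (psi w).
have f01 w : 0 <= f w <= 1 by rewrite /f indicE; case: (_ \in _); rewrite ?lexx ?ler01.
exists f; split.
- by move=> w; case/andP: (f01 w).
- have gf : pmeasurable (fun w => (f w)%:E).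
    apply: (pmeasurable_comp (F := fun u => (\1_(psd_section hn) u)%:E : \bar R) (psi := psi)).
      move=> j d' T' phi mphi; rewrite /comp /psi.
      apply: (pmeasurable_lin _ (phi := fun t i => phi t (enum_val i) - b (enum_val i))) => i.
      by apply: measurable_funB; [exact: mphi | exact: measurable_cst].
    exact: pmeasurable_psd_section.
  have dM0 : \det M != 0 by rewrite gt_eqF.
  have F0 w : (0 <= (f w)%:E)%E by rewrite lee_fin; case/andP: (f01 w).
  rewrite -(leb_int_affine b dM0 F0 gf).
  have -> : (fun u => (f (aff u))%:E) = fun u => (\1_(psd_section hn) u)%:E.
    by apply/funext => u; rewrite /f psiK.
  rewrite lee_wpmul2r //; first by apply: iter_int_ge0 => u; rewrite lee_fin indicE; case: (_ \in _).
  by rewrite lee_fin gtr0_norm.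
- by move=> w; case/andP: (f01 w).
- move=> w; rewrite /f indicE; case: (boolP (_ \in _)) => [/set_mem hw _|]; last by rewrite eqxx.
  exists (sec hn (psi w)); split => //; first exact: sph_form_sec.
  by move=> e; rewrite -{1}(affK w) secaff.
Qed.

(** The quadrature writes the form as a combination of 2m-th powers with coefficients [y v],
    nonnegative because c is psd; their 2m-th roots are absorbed into the linear forms. *)
Lemma Lop_Kcone m c : (k <= m)%N -> Cpsd c ->
  Kcone m (fun e => (c0const R n k m)^-1 * FormOps.Lop m c e).
Proof.
move=> hkm hc; have c0 := c0const_gt0 hkm; set C0 := c0const R n k m in c0 *.
have [I [W [t [W0 hq _ _]]]] := @FormOps.quadrature_identities R n k m hkm.
have m0 : (0 < m)%N by apply: leq_trans hkm.
pose y v := C0^-1 * ((m.*2)`!%:R)^-1 * (W v * ev c (t v)).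
have y0 v : 0 <= y v.
  by rewrite !mulr_ge0 ?invr_ge0 ?ler0n ?(ltW c0) // hc.
pose be v := powR (y v) ((m.*2)%:R^-1).
have beE v : be v ^+ m.*2 = y v.
  rewrite -powR_mulrn ?powR_ge0 // -powRrM mulVf ?powRr1 //.
  by rewrite pnatr_eq0 double_eq0 -lt0n.
exists [seq (fun i => be v * t v i) | v <- enum I] => x.
rewrite big_map big_enum /=.
have -> : ev (fun e => C0^-1 * FormOps.Lop m c e) x = C0^-1 * ev (FormOps.Lop m c) x.
  by rewrite /ev mulr_sumr; apply: eq_bigr => e _; rewrite mulrA.
rewrite mulrCA [r2 x ^+ _ * _]hq mulrA mulr_sumr; apply: eq_bigr => v _.
have -> : \sum_i be v * t v i * x i = be v * \sum_i t v i * x i.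
  by rewrite mulr_sumr; apply: eq_bigr => i _; rewrite mulrA.
by rewrite exprMn beE /y -!mulrA.
Qed.

(** For m = k, [L c] is the sum of W_v c(t_v) q_v with fixed q_v. These coefficients are nonnegative
    for psd c, and their sum 1 / [lam] is fixed by the mean, so the image lies in a box. Dividing by
    the factor from [image_vol] bounds the original volume. *)
Lemma volC_fin : exists2 b : R, 0 <= b & (leb_int (fun u => (\1_(psd_section hn) u)%:E) <= b%:E)%E.
Proof.
have [f [f0 hf f1 hw]] := image_vol (leqnn k).
have [I [W [t [q [W0 hL hq [kap kap0 hkap]]]]]] := @FormOps.Lop_coef R n k.
set rho := Forms.acoef R k k 0 / c0const R n k k in hf.
have rho0 : 0 < rho by rewrite divr_gt0 ?acoef_gt0 ?c0const_gt0.
pose lam := sph_mean (fun x => x (Ordinal (ltnW hn)) ^+ k.*2) / kap.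
have lam0 : 0 < lam.
  apply: divr_gt0 => //; have := S0_gt0 (R := R) k hn; rewrite /S0 monf_e0.
  by congr (0 < sph_mean _).
pose B : R := (c0const R n k k)^-1 * (lam^-1 * \sum_v \sum_e `|q v e|).
have B0 : 0 <= B.
  rewrite !mulr_ge0 ?invr_ge0 ?(ltW lam0) ?(ltW (c0const_gt0 (leqnn k))) //.
  by apply: sumr_ge0 => v _; apply: sumr_ge0.
have hbox w : f w <= \1_(box (fun=> 0) B) w.
  have [->|fw] := eqVneq (f w) 0; first by rewrite indicE; case: (_ \in _).
  have [c [hc Sc hs]] := hw w fw.
  rewrite indicE mem_set ?f1 // => r; rewrite subr0.
  rewrite -(sec_val hn w r) hs normrM ger0_norm ?invr_ge0 ?(ltW (c0const_gt0 (leqnn k))) //.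
  rewrite ler_wpM2l ?invr_ge0 ?(ltW (c0const_gt0 (leqnn k))) // hL.
  apply: le_trans (ler_norm_sum _ _ _) _; rewrite mulr_sumr; apply: ler_sum => v _.
  have ge0 v' : 0 <= W v' * ev c (t v') by rewrite mulr_ge0 // hc.
  have hv : W v * ev c (t v) <= lam^-1.
    have : lam * \sum_v W v * ev c (t v) = 1 by rewrite -(sph_form_quadrature hn kap0 hkap).
    rewrite (bigD1 v) //= => e1.
    rewrite -(ler_pM2l lam0) mulfV ?gt_eqF // -e1 ler_wpM2l ?(ltW lam0) //.
    by rewrite lerDl sumr_ge0.
  rewrite normrM ger0_norm; last exact: ge0.
  apply: ler_pM; [exact: ge0 | by [] | exact: hv | ].
  by rewrite (bigD1 (val r)) //= lerDl sumr_ge0.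
have h2 := leb_int_le_box B0 f0 hbox.
have rN : 0 < rho ^+ #|{: MonRest n k.*2}| by rewrite exprn_gt0.
exists ((rho ^+ #|{: MonRest n k.*2}|)^-1 * (2 * B) ^+ #|{: MonRest n k.*2}|).
  by rewrite mulr_ge0 ?invr_ge0 ?(ltW rN) // exprn_ge0 // mulr_ge0.
rewrite EFinM -(@lee_pmul2l _ (rho ^+ #|{: MonRest n k.*2}|)%:E) ?lte_fin //.
rewrite -!EFinM mulrA mulfV ?gt_eqF // mul1r.
exact: le_trans hf h2.
Qed.

Lemma vol_ratio m : (k <= m)%N ->
  (Forms.acoef R k m 0 / c0const R n k m) ^+ alpha n k.*2 <=
  fine (volM (@Kcone R n k m)) / fine (volM (@Cpsd R n k)).
Proof.
move=> hkm; rewrite !(volME hn) -card_MonRest //.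
have [f [f0 hf f1 hw]] := image_vol hkm.
have [b b0 hb] := volC_fin; have [a a0 ha] := volC_gt0 (R := R) hn hk.
set V := leb_int (fun u => (\1_(psd_section hn) u)%:E) in hf hb ha.
set K := leb_int (fun u => (\1_[set u | Kcone m (sec hn u)] u)%:E).
have fK : (leb_int (fun w => (f w)%:E) <= K)%E.
  apply: iter_int_le => w; rewrite lee_fin //.
  have [->|fw] := eqVneq (f w) 0; first by rewrite indicE; case: (_ \in _).
  have [c [hc Sc hs]] := hw w fw.
  rewrite indicE mem_set //=.
  have -> : sec hn w = fun e => (c0const R n k m)^-1 * FormOps.Lop m c e by apply/funext.
  exact: Lop_Kcone.
(* The inclusion of K(2m) in the psd cone makes its volume finite, so that [fine] loses nothing. *)
have KV : (K <= V)%E.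
  apply: iter_int_le => w; rewrite lee_fin; first by rewrite indicE; case: (_ \in _).
  rewrite !indicE; case: (boolP (w \in [set u | Kcone m (sec hn u)])) => [/set_mem hK|_] //=.
  rewrite mem_set //; exact: (Kcone_psd hk hK).
have V0 : (0 <= V)%E by apply: le_trans ha; rewrite lee_fin ltW.
have Vfin : V \is a fin_num by rewrite ge0_fin_numE // (le_lt_trans hb) // ltry.
have K0 : (0 <= K)%E by apply: iter_int_ge0 => w; rewrite lee_fin indicE; case: (_ \in _).
have Kfin : K \is a fin_num by rewrite ge0_fin_numE // (le_lt_trans KV) // (le_lt_trans hb) // ltry.
have Vpos : 0 < fine V.
  by rewrite -lte_fin fineK //; apply: lt_le_trans ha; rewrite lte_fin.
rewrite ler_pdivlMr // -lee_fin EFinM !fineK //.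
exact: le_trans hf fK.
Qed.

End VolumeComparison.

(** The functional equation applied k times; m >= 1 and n >= 2 keep all arguments above 1. *)
Lemma Gamma_falling (R : realType) (n m k : nat) : (1 < n)%N -> (0 < m)%N ->
  Gamma ((m.*2 + k.*2 + n)%:R / 2 : R) =
  falling (m%:R + k%:R - 1 + n%:R / 2) k * Gamma ((m.*2 + n)%:R / 2 : R).
Proof.
move=> hn hm.
have n2 : (2 : R) <= n%:R by rewrite ler_nat.
have m1 : (1 : R) <= m%:R by rewrite ler1n.
have -> : (m.*2 + n)%:R / 2 = m%:R + n%:R / 2 :> R.
  by rewrite natrD -muln2 natrM; field.
have -> : (m.*2 + k.*2 + n)%:R / 2 = m%:R + k%:R + n%:R / 2 :> R.
  by rewrite !natrD -!muln2 !natrM; field.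
elim: k => [|k IH]; first by rewrite /falling big_ord0 mul1r addr0.
have -> : m%:R + k.+1%:R + n%:R / 2 = (m%:R + k%:R + n%:R / 2) + 1 :> R.
  by rewrite -natr1; ring.
have k0 : (0 : R) <= k%:R by rewrite ler0n.
rewrite GammaS; last by lra.
rewrite IH mulrA; congr (_ * _).
rewrite /falling big_ord_recl /= subr0; congr (_ * _); first by rewrite -natr1; ring.
by apply: eq_bigr => i _; rewrite /bump /= natrD -natr1; ring.
Qed.

Theorem theorem7p10 (R : realType) (n k m : nat) :
  (2 <= n)%N -> (1 <= k)%N -> (k <= m)%N ->
  powR (fine (volM (@Kcone R n k m)) / fine (volM (@Cpsd R n k)))
       ((alpha n k.*2)%:R^-1)
  >= (m`!)%:R * Gamma ((m.*2 + n)%:R / 2)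
     / ((m - k)`!%:R * Gamma ((m.*2 + k.*2 + n)%:R / 2)).
Proof.
move=> hn hk hkm.
have hm : (0 < m)%N by apply: leq_trans hkm.
have [rho0 ratio] : 0 < Forms.acoef R k m 0 / c0const R n k m /\
    Forms.acoef R k m 0 / c0const R n k m =
    (m`!)%:R / (((m - k)`!)%:R * falling (m%:R + k%:R - 1 + n%:R / 2) k).
  by split; [rewrite divr_gt0 ?acoef_gt0 ?c0const_gt0 | exact: ratioE].
set rho := Forms.acoef R k m 0 / c0const R n k m in rho0 ratio.
have F0 := falling_gt0 R k m hn.
have f0 : ((m - k)`!)%:R != 0 :> R by rewrite pnatr_eq0 -lt0n fact_gt0.
apply: (@le_trans _ _ rho).
  rewrite Gamma_falling //; set G := Gamma _.
  (* If this Gamma value were 0, the claimed bound would be 0, hence below [rho]; otherwise it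
     cancels. *)
  have [->|G0] := eqVneq G 0; first by rewrite !mulr0 mul0r ltW.
  rewrite le_eqVlt ratio; apply/orP; left; apply/eqP; field.
  by rewrite G0 f0 gt_eqF.
have al0 := alpha_gt0 hn hk.
have h := vol_ratio (R := R) hn hk hkm.
rewrite -/rho in h.
apply: (@le_trans _ _ (powR (rho ^+ alpha n k.*2) ((alpha n k.*2)%:R^-1))).
  rewrite -powR_mulrn ?(ltW rho0) // -powRrM mulfV ?powRr1 ?(ltW rho0) //.
  by rewrite pnatr_eq0 -lt0n.
apply: ge0_ler_powR; rewrite ?nnegrE ?invr_ge0 ?ler0n ?exprn_ge0 ?(ltW rho0) //.
by apply: le_trans h; rewrite exprn_ge0 // ltW.
Qed.
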